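(* For any sequence of encoding-decoding-reproduction functions $(f^{(n)},g^{(n)},h^{(n)})$ such that \begin{align} \limsup_{n\to\infty}\frac{1}{n}\log L&\leq R^{\mathrm{c}},~\liminf_{n\to\infty}\frac{1}{n}\log M\geq R^{\mathrm{i}}, \end{align} given a distortion level $D$, we have that if $(R^{\mathrm{i}},R^{\mathrm{c}},D)\notin\mathcal{R}$, then the probability of correct decoding vanishes to zero exponentially fast as $n$ goes to infinity.
   Context: Setting (content identification with lossy recovery): $\mathcal{X},\mathcal{Y},\mathcal{Z},\hat{\mathcal{X}}$ are finite alphabets and $d:\mathcal{X}\times\hat{\mathcal{X}}\to[0,\infty)$ is a distortion measure with $d(x^n,\hat{x}^n)=\frac{1}{n}\sum_{i=1}^n d(x_i,\hat{x}_i)$. There are $M$ feature vectors $X^n(1),\ldots,X^n(M)$ generated i.i.d. according to $P_X^n$. Enrollment: for each $m$, $Y^n(m)$ is the output of a DMC $P_{Y|X}$ with input $X^n(m)$, and a deterministic encoder $f^{(n)}:\mathcal{Y}^n\to\{1,\ldots,L\}$ stores $S(m)=f^{(n)}(Y^n(m))$. Identification: an index $W$, uniform on $\{1,\ldots,M\}$ and independent of everything else, is drawn; the user observes $Z^n$, the output of a DMC $P_{Z|X}$ with input $X^n(W)$, and computes $\hat{W}=g^{(n)}(S(1),\ldots,S(M),Z^n)$ with a deterministic $g^{(n)}$. Lossy recovery: $\hat{X}^n=h^{(n)}(S(\hat{W}),Z^n)$ with a deterministic $h^{(n)}$. The error probability is $\mathrm{P}_{\rm{e}}^{(n)}(f^{(n)},g^{(n)},h^{(n)},D)=\Pr\{\hat{W}\neq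 W~\textrm{or}~d(X^n(W),\hat{X}^n)>D\}$ and the probability of correct decoding is $1-\mathrm{P}_{\rm{e}}^{(n)}$. Definition of $\mathcal{R}$: a triple $(R^{\mathrm{i}},R^{\mathrm{c}},D)$ is $\varepsilon$-achievable if there is a sequence $(f^{(n)},g^{(n)},h^{(n)})$ with $\liminf_n\frac{1}{n}\log M\geq R^{\mathrm{i}}$, $\limsup_n\frac{1}{n}\log L\leq R^{\mathrm{c}}$, $\limsup_n\mathrm{P}_\mathrm{e}^{(n)}\leq\varepsilon$; $\mathcal{R}(\varepsilon)$ is the closure of such triples and $\mathcal{R}=\bigcap_{\varepsilon\in(0,1)}\mathcal{R}(\varepsilon)$. By Tuncel and Gündüz, $\mathcal{R}$ equals the union, over joint distributions $Q_{XYZU\hat{X}}$ with $|\mathcal{U}|\leq|\mathcal{Y}|+2$, $Z-X-Y-U$, $Q_X=P_X$, $Q_{Y|X}=P_{Y|X}$, $Q_{Z|X}=P_{Z|X}$ and $\hat{X}=\phi(U,Z)$ for some function $\phi$, of the sets $\{(R^{\mathrm{i}},R^{\mathrm{c}},D):R^{\mathrm{i}}\leq I(Q_U,Q_{Z|U}),~R^{\mathrm{c}}-R^{\mathrm{i}}\geq I(Q_{U|Z},Q_{Y|UZ}|Q_Z),~D\geq \mathbb{E}_{Q_{X\hat{X}}}[d(X,\hat{X})]\}$. *)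

(* Defs.v *)
From HB Require Import structures.
From mathcomp Require Import all_boot all_order all_algebra.
From mathcomp Require Import all_classical all_reals all_analysis.
Set Implicit Arguments. Unset Strict Implicit. Unset Printing Implicit Defensive.
Import Order.TTheory GRing.Theory Num.Theory numFieldNormedType.Exports.
Local Open Scope ring_scope.
Local Open Scope classical_set_scope.

Section ContentId.
Variable R : realType.

Definition is_pmf (T : finType) (P : T -> R) : Prop :=
  (forall x, 0 <= P x) /\ \sum_(x : T) P x = 1.

Definition is_channel (X Y : finType) (W : X -> Y -> R) : Prop :=
  forall x, is_pmf (W x).

Definition iid (X : finType) (P : X -> R) (n : nat) (x : {ffun 'I_n -> X}) : R :=
  \prod_(i < n) P (x i).

Definition dmc (X Y : finType) (W : X -> Y -> R) (n : nat)
  (x : {ffun 'I_n -> X}) (y : {ffun 'I_n -> Y}) : R :=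
  \prod_(i < n) W (x i) (y i).

Definition avg_dist (X Xh : finType) (d : X -> Xh -> R) (n : nat)
  (x : {ffun 'I_n -> X}) (xh : {ffun 'I_n -> Xh}) : R :=
  (\sum_(i < n) d (x i) (xh i)) / n%:R.

Variables (X Y Z Xh : finType) (PX : X -> R) (PYX : X -> Y -> R)
  (PZX : X -> Z -> R) (d : X -> Xh -> R).

(* Error probability Pr{ What <> W or d(X^n(W), Xh^n) > D } for a code with
   M feature vectors, L = number of stored-message values (messages 'I_L,
   i.e. {0,...,L-1} standing for {1,...,L}), encoder f, decoder g,
   reproduction h.  The probability is the exact finite sum over the joint
   law of W (uniform), X^n(1..M) (iid P_X^n), Y^n(1..M) (DMC P_{Y|X}) and
   Z^n (DMC P_{Z|X} with input X^n(W)). *)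
Definition error_prob (n M L : nat)
  (f : {ffun 'I_n -> Y} -> 'I_L)
  (g : {ffun 'I_M -> 'I_L} -> {ffun 'I_n -> Z} -> 'I_M)
  (h : 'I_L -> {ffun 'I_n -> Z} -> {ffun 'I_n -> Xh}) (D : R) : R :=
  \sum_(w : 'I_M)
  \sum_(xs : {ffun 'I_M -> {ffun 'I_n -> X}})
  \sum_(ys : {ffun 'I_M -> {ffun 'I_n -> Y}})
  \sum_(z : {ffun 'I_n -> Z})
    (M%:R)^-1 * (\prod_(m < M) (iid PX (xs m) * dmc PYX (xs m) (ys m)))
      * dmc PZX (xs w) z *
    (let S : {ffun 'I_M -> 'I_L} := [ffun m => f (ys m)] in
     let what := g S z in
     if (what != w) || (D < avg_dist d (xs w) (h (S what) z)) then 1 else 0).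

Definition eps_achievable (eps : R) (t : R * R * R) : Prop :=
  let Ri := t.1.1 in let Rc := t.1.2 in let D := t.2 in
  exists (M L : nat -> nat)
         (f : forall n, {ffun 'I_n -> Y} -> 'I_(L n))
         (g : forall n, {ffun 'I_(M n) -> 'I_(L n)} -> {ffun 'I_n -> Z} -> 'I_(M n))
         (h : forall n, 'I_(L n) -> {ffun 'I_n -> Z} -> {ffun 'I_n -> Xh}),
    [/\ (forall n, (0 < M n)%N),
        (Ri%:E <= limn_einf (fun n => (ln (M n)%:R / n%:R)%:E))%E,
        (limn_esup (fun n => (ln (L n)%:R / n%:R)%:E) <= Rc%:E)%E &
        (limn_esup (fun n => (error_prob (f n) (g n) (h n) D)%:E) <= eps%:E)%E].

Definition region_eps (eps : R) : set (R * R * R) :=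
  closure [set t | eps_achievable eps t].

Definition region : set (R * R * R) :=
  \bigcap_(eps in [set e : R | 0 < e < 1]) region_eps eps.

End ContentId.

(* Main.v *)
(** The proof is operational: no single-letter formula is used. Suppose that
    for every E > 0 there are arbitrarily large n at which the code succeeds
    with probability at least exp(-nE).

    - Freezing the stored messages of all users but one turns the decoder into
      a test between (S, Z) and an independent pair, with false-alarm
      probability about 1/M and detection probability about exp(-nE).
    - A set of probability exp(-n l^2) in a product space has a neighbourhood
      of Hamming radius O(nl) of probability close to 1 (blowing-up lemma), and
      passing to this neighbourhood costs only a factor exp(n o(1)) in
      false-alarm probability. Hence the encoder may replace y by the nearest
      good sequence and the test may accept every z that is close to an
      accepted one.
    - The decoder then has a list of exp(n o(1)) candidate reproductions. The
      encoder also stores y at a few fixed positions, and the decoder keeps the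
      candidate with the least expected distortion on these positions. By
      concentration its distortion is nearly optimal.
    - Now the block code succeeds with probability close to 1. Using q
      independent blocks as super-letters and accepting when most blocks
      accept, the law of large numbers makes the error vanish as q grows, with
      rates and distortion perturbed by o(1).

    Hence (Ri, Rc, D) is a limit of achievable triples. *)
Require Import Defs.
From HB Require Import structures.
From mathcomp Require Import all_boot all_order all_algebra.
From mathcomp Require Import all_classical all_reals all_analysis.
From mathcomp Require Import ring lra.
Set Implicit Arguments. Unset Strict Implicit. Unset Printing Implicit Defensive.
Import Order.TTheory GRing.Theory Num.Theory numFieldNormedType.Exports.
Local Open Scope ring_scope.

(** * Expectations over finite product spaces *)

Section ProductExpectation.
Variable R : realType.
Implicit Types I J T : finType.

(** The law may vary with the coordinate, so one operator covers i.i.d. sources, [fun=> p], and the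
    output of a memoryless channel with fixed input, [fun i => W (y i)]. *)
Definition Ex I T (p : I -> T -> R) (F : {ffun I -> T} -> R) : R :=
  \sum_(t : {ffun I -> T}) (\prod_i p i (t i)) * F t.

Lemma eq_Ex I T (p : I -> T -> R) F G : F =1 G -> Ex p F = Ex p G.
Proof. by move=> FG; apply: eq_bigr => t _; rewrite FG. Qed.

Lemma Ex_prod I T (p : I -> T -> R) (phi : I -> T -> R) :
  Ex p (fun t => \prod_i phi i (t i)) = \prod_i \sum_a p i a * phi i a.
Proof.
rewrite bigA_distr_bigA /=; apply: eq_bigr => t _.
by rewrite big_split.
Qed.

Lemma ExD I T (p : I -> T -> R) F G : Ex p (fun t => F t + G t) = Ex p F + Ex p G.
Proof. by rewrite -big_split; apply: eq_bigr => t _; rewrite mulrDr. Qed.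

Lemma ExZ I T (p : I -> T -> R) c F : Ex p (fun t => c * F t) = c * Ex p F.
Proof. by rewrite big_distrr; apply: eq_bigr => t _; rewrite /= mulrCA. Qed.

Lemma ExZr I T (p : I -> T -> R) c F : Ex p (fun t => F t * c) = Ex p F * c.
Proof. by rewrite mulrC -ExZ; apply: eq_Ex => t; rewrite mulrC. Qed.

Lemma ExN I T (p : I -> T -> R) F : Ex p (fun t => - F t) = - Ex p F.
Proof. by rewrite -mulN1r -ExZ; apply: eq_Ex => t; rewrite mulN1r. Qed.

Lemma ExB I T (p : I -> T -> R) F G : Ex p (fun t => F t - G t) = Ex p F - Ex p G.
Proof. by rewrite ExD ExN. Qed.

Lemma Ex_sum I T (K : finType) (p : I -> T -> R) (P : pred K) (F : K -> {ffun I -> T} -> R) :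
  Ex p (fun t => \sum_(k | P k) F k t) = \sum_(k | P k) Ex p (F k).
Proof. by rewrite exchange_big; apply: eq_bigr => t _; rewrite big_distrr. Qed.

Lemma Ex_ge0 I T (p : I -> T -> R) F : (forall i, is_pmf (p i)) ->
  (forall t, 0 <= F t) -> 0 <= Ex p F.
Proof.
move=> pp F0; apply: sumr_ge0 => t _; apply: mulr_ge0 (F0 t).
by apply: prodr_ge0 => i _; apply: (pp i).1.
Qed.

Lemma le_Ex I T (p : I -> T -> R) F G : (forall i, is_pmf (p i)) ->
  (forall t, F t <= G t) -> Ex p F <= Ex p G.
Proof.
move=> pp FG; rewrite -subr_ge0 -ExB; apply: Ex_ge0 => // t.
by rewrite subr_ge0.
Qed.

Lemma Ex_const I T (p : I -> T -> R) c : (forall i, is_pmf (p i)) ->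
  Ex p (fun=> c) = c.
Proof.
move=> pp; transitivity (Ex p (fun=> 1) * c).
  by rewrite -ExZr; apply: eq_Ex => t; rewrite mul1r.
rewrite (_ : Ex p (fun=> 1) = 1) ?mul1r //.
transitivity (Ex p (fun t => \prod_(i : I) (fun _ _ => 1) i (t i))).
  by apply: eq_Ex => t; rewrite big1.
rewrite (Ex_prod p (fun _ _ => 1)); apply: big1 => i _.
by under eq_bigr do rewrite mulr1; apply: (pp i).2.
Qed.

Lemma is_pmf_prod I T (p : I -> T -> R) : (forall i, is_pmf (p i)) ->
  is_pmf (fun t : {ffun I -> T} => \prod_i p i (t i)).
Proof.
move=> pp; split=> [t|]; first by apply: prodr_ge0 => i _; apply: (pp i).1.
by rewrite -[RHS](Ex_const 1 pp); apply: eq_bigr => t _; rewrite mulr1.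
Qed.

(** The probabilistic method: were [F] above [K] everywhere, the nonpositive mean of [F - K] would
    force every weight to vanish, against total mass one. *)
Lemma Ex_exists_le I T (p : I -> T -> R) F K : (forall i, is_pmf (p i)) ->
  Ex p F <= K -> exists t, F t <= K.
Proof.
move=> pp FK; have [t Ft|N] := pickP (fun t => F t <= K); first by exists t.
have F0 t : 0 < F t - K by rewrite subr_gt0 ltNge N.
have [p0 p1] := is_pmf_prod pp.
have : Ex p (fun t => F t - K) <= 0 by rewrite ExB Ex_const // subr_le0.
rewrite le_eqVlt ltNge Ex_ge0 ?orbF => // [|t]; last exact: ltW.
rewrite psumr_eq0 => [/allP H|t _]; last by rewrite mulr_ge0 // ltW.
have : \sum_(t : {ffun I -> T}) \prod_i p i (t i) = 0.
  apply: big1 => t _; have := H t (mem_index_enum t).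
  by rewrite mulf_eq0 (gt_eqF (F0 t)) orbF => /eqP.
by move/eqP; rewrite p1 oner_eq0.
Qed.

Lemma natr_forall I (b : pred I) : ([forall i, b i]%:R : R) = \prod_i (b i)%:R.
Proof.
apply/esym; case: forallP => [H|/forallP].
  by apply: big1 => i _; rewrite H.
rewrite negb_forall => /existsP[i /negbTE bi].
by rewrite (bigD1 i) //= bi mul0r.
Qed.

Lemma ffun_eq_forall I T (t u : {ffun I -> T}) : (t == u) = [forall i, t i == u i].
Proof. by apply/eqP/forallP => [-> //|H]; apply/ffunP => i; apply/eqP. Qed.

(* Functions of several coordinates of a product are handled by expanding
   them over point indicators, which factor over the coordinates. *)
Lemma Ex_indic I T (p : I -> T -> R) (K : finType) (G : K -> R) (phi : {ffun I -> T} -> K) :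
  Ex p (fun t => G (phi t)) = \sum_k G k * Ex p (fun t => (phi t == k)%:R).
Proof.
under [RHS]eq_bigr do rewrite -ExZ.
rewrite -Ex_sum; apply: eq_Ex => t.
rewrite (bigD1 (phi t)) //= eqxx mulr1 big1 ?addr0 // => k.
by rewrite eq_sym => /negbTE ->; rewrite mulr0.
Qed.

Lemma sum_indic T (p : T -> R) (a : T) : \sum_b p b * (b == a)%:R = p a.
Proof.
rewrite (bigD1 a) //= eqxx mulr1 big1 ?addr0 // => b /negbTE ->.
by rewrite mulr0.
Qed.

(** Marginalization: point indicators factor over [I], and the coordinates outside the image of
    [phi] sum to one. *)
Lemma Ex_inj I J T (p : I -> T -> R) (phi : J -> I) (G : {ffun J -> T} -> R) :
  (forall i, is_pmf (p i)) -> injective phi ->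
  Ex p (fun t => G [ffun j => t (phi j)]) = Ex (fun j => p (phi j)) G.
Proof.
move=> pp phiI; rewrite (Ex_indic p G (fun t => [ffun j => t (phi j)])) /Ex.
apply: eq_bigr => u _; rewrite mulrC; congr (_ * _).
pose psi i a : R := [forall j, (phi j == i) ==> (a == u j)]%:R.
transitivity (Ex p (fun t => \prod_i psi i (t i))).
  apply: eq_Ex => t; rewrite /psi -natr_forall; congr (_%:R); congr (nat_of_bool _).
  rewrite ffun_eq_forall; apply/forallP/forallP => [H i|H j].
    by apply/forallP => j; apply/implyP => /eqP <-; have := H j; rewrite ffunE.
  by rewrite ffunE; have /forallP/(_ j) := H (phi j); rewrite eqxx.
rewrite Ex_prod.
rewrite (bigID (fun i => i \in imset phi (mem predT))) /=.
rewrite [X in _ * X]big1 ?mulr1; last first.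
  move=> i iN; rewrite -[RHS](pp i).2; apply: eq_bigr => a _.
  rewrite /psi (_ : [forall j, _]) ?mulr1 //; apply/forallP => j.
  by apply/implyP => /eqP ji; rewrite -ji imset_f ?inE in iN.
rewrite big_imset /=; last by move=> i j _ _; apply: phiI.
apply: eq_big => [j|j _]; first by rewrite inE.
rewrite -[RHS]sum_indic; apply: eq_bigr => a _; congr (_ * _%:R).
congr nat_of_bool; apply/forallP/eqP => [/(_ j)|-> k]; first by rewrite eqxx => /eqP.
by apply/implyP => /eqP/phiI ->.
Qed.

(** At a fixed outcome [u] the old coordinate [w] sums out to one and the fresh draw supplies
    [p w (u w)]. This later separates one user from the others. *)
Lemma Ex_resample I T (p : I -> T -> R) (w : I) (F : {ffun I -> T} -> R) :
  (forall i, is_pmf (p i)) ->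
  Ex p (fun t => \sum_a p w a * F [ffun i => if i == w then a else t i]) = Ex p F.
Proof.
move=> pp; rewrite Ex_sum.
under eq_bigr => a _ do
  rewrite (Ex_indic p (fun u => p w a * F u) (fun t => [ffun i => if i == w then a else t i])).
rewrite exchange_big; apply: eq_bigr => u _ /=.
under eq_bigr => a _ do rewrite mulrAC.
rewrite -big_distrl /=; congr (_ * _).
transitivity (\sum_a p w a * ((a == u w)%:R *
    \prod_(i | i != w) \sum_b p i b * (b == u i)%:R)).
  apply: eq_bigr => a _; congr (_ * _).
  pose psi i b : R := if i == w then (a == u w)%:R else (b == u i)%:R.
  transitivity (Ex p (fun t => \prod_i psi i (t i))).
    apply: eq_Ex => t; rewrite ffun_eq_forall natr_forall; apply: eq_bigr => i _.
    by rewrite ffunE /psi; case: (eqVneq i w) => [->|_].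
  rewrite Ex_prod (bigD1 w) //= /psi eqxx -big_distrl /= (pp w).2 mul1r.
  congr (_ * _); apply: eq_bigr => i /negbTE iw; apply: eq_bigr => b _.
  by rewrite iw.
transitivity (\sum_a p w a * (a == u w)%:R * \prod_(i | i != w) p i (u i)).
  apply: eq_bigr => a _; rewrite mulrA; congr (_ * _).
  by apply: eq_bigr => i _; rewrite sum_indic.
by rewrite -big_distrl /= sum_indic [RHS](bigD1 w).
Qed.

Lemma sum_ffun_pair I (A B : finType) (F : {ffun I -> A} -> {ffun I -> B} -> R) :
  \sum_a \sum_b F a b =
  \sum_(t : {ffun I -> A * B}) F [ffun i => (t i).1] [ffun i => (t i).2].
Proof.
rewrite pair_bigA /=.
rewrite (reindex (fun t : {ffun I -> A * B} => ([ffun i => (t i).1], [ffun i => (t i).2]))) //.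
exists (fun ab : {ffun I -> A} * {ffun I -> B} => [ffun i => (ab.1 i, ab.2 i)]).
  by move=> t _; apply/ffunP => i; rewrite !ffunE -surjective_pairing.
by move=> [a b] _; congr pair; apply/ffunP => i; rewrite !ffunE.
Qed.

(** Splitting off the first coordinate drives the inductions on the dimension below. *)
Definition fcons n T (a : T) (t : {ffun 'I_n -> T}) : {ffun 'I_n.+1 -> T} :=
  [ffun i => if unlift ord0 i is Some j then t j else a].

Lemma fcons0 n T (a : T) (t : {ffun 'I_n -> T}) : fcons a t ord0 = a.
Proof. by rewrite ffunE unlift_none. Qed.

Lemma fconsS n T (a : T) (t : {ffun 'I_n -> T}) j : fcons a t (lift ord0 j) = t j.
Proof. by rewrite ffunE liftK. Qed.

Lemma sum_ffun_cons n T (F : {ffun 'I_n.+1 -> T} -> R) :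
  \sum_t F t = \sum_a \sum_(t : {ffun 'I_n -> T}) F (fcons a t).
Proof.
rewrite pair_bigA /=.
rewrite (reindex (fun at_ : T * {ffun 'I_n -> T} => fcons at_.1 at_.2)) //.
exists (fun t : {ffun 'I_n.+1 -> T} => (t ord0, [ffun j => t (lift ord0 j)])).
  move=> [a t] _; congr pair; first by rewrite fcons0.
  by apply/ffunP => i; rewrite ffunE fconsS.
move=> t _; apply/ffunP => i; rewrite ffunE /=.
by case: unliftP => [j ->|->] //; rewrite ffunE.
Qed.

Lemma Ex_cons n T (p : 'I_n.+1 -> T -> R) (F : {ffun 'I_n.+1 -> T} -> R) :
  Ex p F = \sum_a p ord0 a * Ex (fun j => p (lift ord0 j)) (fun t => F (fcons a t)).
Proof.
rewrite /Ex sum_ffun_cons; apply: eq_bigr => a _; rewrite big_distrr.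
apply: eq_bigr => t _ /=; rewrite big_ord_recl fcons0 -mulrA.
by congr (_ * (_ * _)); apply: eq_bigr => j _; rewrite fconsS.
Qed.

Lemma Ex_ord0 T (p : 'I_0 -> T -> R) F : Ex p F = F (ffun0 (card_ord 0)).
Proof.
rewrite /Ex; set t0 := ffun0 _; rewrite (bigD1 t0) //= big_ord0 mul1r.
by rewrite big1 ?addr0 // => t /eqP[]; apply/ffunP => -[].
Qed.
End ProductExpectation.

(** * Concentration and blowing-up *)

Section Concentration.
Variable R : realType.
Implicit Types T : finType.

Definition dH (I T : finType) (s t : {ffun I -> T}) : nat := (\sum_i (s i != t i))%N.

Lemma dHxx (I T : finType) (s : {ffun I -> T}) : dH s s = 0%N.
Proof. by apply: big1 => i _; rewrite eqxx. Qed.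

Lemma dHC (I T : finType) (s t : {ffun I -> T}) : dH s t = dH t s.
Proof. by apply: eq_bigr => i _; rewrite eq_sym. Qed.

Lemma dH_triangle (I T : finType) (t s u : {ffun I -> T}) :
  (dH s u <= dH s t + dH t u)%N.
Proof.
rewrite -big_split; apply: leq_sum => i _ /=.
by case: eqVneq => // su; case: (eqVneq (s i) (t i)) => //= <-; rewrite su.
Qed.

Lemma dH_cons n T a b (s t : {ffun 'I_n -> T}) :
  dH (fcons a s) (fcons b t) = ((a != b) + dH s t)%N.
Proof.
rewrite /dH big_ord_recl !fcons0; congr (_ + _)%N.
by apply: eq_bigr => i _; rewrite !fconsS.
Qed.

Definition lip (I T : finType) (f : {ffun I -> T} -> R) :=
  forall s t, f s - f t <= (dH s t)%:R.

(** From [1 - x <= expR (- x)] one gets expR x <= 1/(1 - x), and the product of 1 - x with 1 + x +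
    2x^2 exceeds 1 by x^2(1 - 2x). *)
Lemma expR_le_quad (x : R) : x <= 2^-1 -> expR x <= 1 + x + 2 * x ^+ 2.
Proof.
move=> x2; have x1 : 0 < 1 - x by lra.
have : 1 - x <= expR (- x) by apply: expR_ge1Dx.
rewrite expRN => /(ler_wpM2l (ltW (expR_gt0 x))).
rewrite divff ?gt_eqF ?expR_gt0 // => H.
rewrite -(ler_pM2r x1); apply: (le_trans H).
rewrite -subr_ge0 (_ : _ - _ = x ^+ 2 * (1 - 2 * x)); last by ring.
by apply: mulr_ge0; [exact: sqr_ge0|lra].
Qed.

Lemma ge1_expR (x : R) : 0 <= x -> 1 <= expR x.
Proof. by move=> x0; rewrite -[leLHS](expR0 R) ler_expR. Qed.

(** In the quadratic bound on the exponential the linear term has mean zero, and the deviation from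
    the mean is at most 1 in absolute value. *)
Lemma hoeffding T (p : T -> R) (u : T -> R) (l : R) :
  is_pmf p -> 0 <= l <= 2^-1 -> (forall a b, u a - u b <= 1) ->
  \sum_a p a * expR (l * (u a - \sum_b p b * u b)) <= expR (2 * l ^+ 2).
Proof.
move=> [p0 p1] /andP[l0 l2] u1; set m := \sum_b p b * u b.
have um a : `|u a - m| <= 1.
  have E : u a - m = \sum_b p b * (u a - u b).
    under eq_bigr do rewrite mulrBr.
    rewrite sumrB -big_distrl /= p1 mul1r. by [].
  rewrite E ler_norml; apply/andP; split.
    rewrite -p1 -sumrN; apply: ler_sum => b _; rewrite -mulrN1 ler_wpM2l //.
    by have := u1 b a; lra.
  by rewrite -p1; apply: ler_sum => b _; rewrite -[leRHS]mulr1 ler_wpM2l.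
apply: (@le_trans _ _ (\sum_a p a * (1 + l * (u a - m) + 2 * l ^+ 2))).
  apply: ler_sum => a _; rewrite ler_wpM2l //.
  have := um a; rewrite ler_norml => /andP[ua ub].
  apply: (le_trans (expR_le_quad _)); first by nra.
  rewrite lerD2l ler_pM2l // exprMn -[leRHS]mulr1 ler_wpM2l ?sqr_ge0 //.
  by rewrite -[leLHS]real_normK ?num_real // expr_le1.
under eq_bigr do rewrite mulrDr mulrDr mulr1 mulrCA mulrBr.
rewrite !big_split /= -!big_distrl /= -big_distrr /= big_split /= sumrN.
rewrite -big_distrl /= !p1 !mul1r subrr mulr0 addr0.
exact: expR_ge1Dx.
Qed.

Lemma Ex_lip n T (p : 'I_n.+1 -> T -> R) f : (forall i, is_pmf (p i)) -> lip f ->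
  forall a b, Ex (fun j => p (lift ord0 j)) (fun t => f (fcons a t)) -
    Ex (fun j => p (lift ord0 j)) (fun t => f (fcons b t)) <= (a != b)%:R.
Proof.
move=> pp lf a b; rewrite -ExB.
have pp' j : is_pmf (p (lift ord0 j)) by [].
rewrite -[leRHS](Ex_const _ pp'); apply: le_Ex => // t.
by apply: (le_trans (lf _ _)); rewrite dH_cons dHxx addn0.
Qed.

(** Induction on [n]: the conditional mean [g a] given the first coordinate oscillates by at most 1,
    so [hoeffding] applies to it, and the induction hypothesis handles the fluctuation around
    [g a]. *)
Lemma mcdiarmid n T (p : 'I_n -> T -> R) f (l : R) :
  (forall i, is_pmf (p i)) -> lip f -> 0 <= l <= 2^-1 ->
  Ex p (fun t => expR (l * (f t - Ex p f))) <= expR (2 * n%:R * l ^+ 2).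
Proof.
move=> pp lf ll; elim: n p f pp lf => [|n IH] p f pp lf.
  by rewrite !Ex_ord0 subrr !mulr0 mul0r expR0.
set p' := fun j => p (lift ord0 j).
pose g a := Ex p' (fun t => f (fcons a t)).
have Eg : Ex p f = \sum_a p ord0 a * g a by rewrite Ex_cons.
rewrite Ex_cons -/p' Eg.
apply: (@le_trans _ _ (\sum_a p ord0 a *
    (expR (l * (g a - \sum_b p ord0 b * g b)) * expR (2 * n%:R * l ^+ 2)))).
  apply: ler_sum => a _; rewrite ler_wpM2l ?(pp _).1 //.
  set c := g a - _.
  rewrite (_ : Ex _ _ = expR (l * c) * Ex p' (fun t => expR (l * (f (fcons a t) - g a)))).
    rewrite ler_wpM2l ?expR_ge0 //; apply: IH => //.
      by move=> i; apply: pp.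
    by move=> s t; apply: (le_trans (lf _ _)); rewrite dH_cons eqxx.
  rewrite -ExZ; apply: eq_Ex => t; rewrite -expRD; congr expR.
  by rewrite /c; ring.
under eq_bigr do rewrite mulrA.
rewrite -big_distrl /=.
apply: (@le_trans _ _ (expR (2 * l ^+ 2) * expR (2 * n%:R * l ^+ 2))).
  rewrite ler_wpM2r ?expR_ge0 // hoeffding // => a b.
  by apply: (le_trans (Ex_lip pp lf a b)); rewrite lern1 leq_b1.
by rewrite -expRD -[n.+1]addn1 natrD ler_expR; lra.
Qed.

Lemma lipN (I T : finType) (f : {ffun I -> T} -> R) : lip f -> lip (fun t => - f t).
Proof. by move=> lf s t; rewrite opprK addrC dHC; apply: lf. Qed.

Lemma tail_upper n T (p : 'I_n -> T -> R) f (e : R) :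
  (forall i, is_pmf (p i)) -> lip f -> 0 <= e <= 2 ->
  Ex p (fun t => (Ex p f + n%:R * e <= f t)%R%:R) <= expR (- (n%:R * e ^+ 2 / 8)).
Proof.
move=> pp lf /andP[e0 e2].
(* The choice l = e/4 minimizes 2nl^2 - nle; [e <= 2] keeps it within 1/2. *)
have l2 : 0 <= e / 4 <= 2^-1 by apply/andP; split; lra.
have := mcdiarmid pp lf l2.
rewrite -(ler_pM2l (expR_gt0 (- (n%:R * e ^+ 2 / 4)))) -expRD -ExZ.
rewrite (_ : - _ + _ = - (n%:R * e ^+ 2 / 8)); last by field.
apply: le_trans; apply: le_Ex => // t; rewrite -expRD.
case: (leP _ (f t)) => /= [H|_]; last by rewrite expR_ge0.
apply: ge1_expR; have : n%:R * e <= f t - Ex p f by lra.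
by move=> /(ler_wpM2l e0); lra.
Qed.

Lemma tail_lower n T (p : 'I_n -> T -> R) f (e : R) :
  (forall i, is_pmf (p i)) -> lip f -> 0 <= e <= 2 ->
  Ex p (fun t => (f t <= Ex p f - n%:R * e)%R%:R) <= expR (- (n%:R * e ^+ 2 / 8)).
Proof.
move=> pp /lipN lf e2; apply: le_trans (tail_upper pp lf e2).
apply: le_Ex => // t; rewrite ExN ler_nat; case: leP => //= H.
by case: leP => //= H'; lra.
Qed.

Section Nearest.
Variables (I T : finType) (A : pred {ffun I -> T}) (a0 : {ffun I -> T}) (Aa0 : A a0).

Definition nearest (t : {ffun I -> T}) := [arg min_(u < a0 | A u) dH t u].

Lemma nearestP t : A (nearest t).
Proof. by rewrite /nearest; case: arg_minnP. Qed.

Lemma nearest_min t u : A u -> (dH t (nearest t) <= dH t u)%N.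
Proof. by rewrite /nearest; case: arg_minnP => // v _; apply. Qed.

Lemma lip_nearest : lip (fun t => (dH t (nearest t))%:R).
Proof.
move=> s t; rewrite lerBlDr -natrD ler_nat.
by apply: leq_trans (nearest_min s (nearestP t)) _; apply: dH_triangle.
Qed.
End Nearest.

(** Apply [mcdiarmid] to minus the distance to [A], which vanishes on [A]: exp(lm) P(A) <=
    exp(2nl^2), and the lower bound on P(A) leaves m <= 3nl. *)
Lemma blowup n T (p : 'I_n -> T -> R) (A : pred {ffun 'I_n -> T}) a0 (l : R) :
  (forall i, is_pmf (p i)) -> 0 < l <= 2^-1 -> A a0 ->
  expR (- (n%:R * l ^+ 2)) <= Ex p (fun t => (A t)%:R) ->
  Ex p (fun t => (dH t (nearest A a0 t))%:R) <= 3 * n%:R * l.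
Proof.
move=> pp /andP[l0 l2] Aa0 PA; set m := Ex p _.
have lf := lip_nearest Aa0.
have l02 : 0 <= l <= 2^-1 by rewrite ltW.
have := mcdiarmid pp (lipN lf) l02.
have H : expR (l * m) * expR (- (n%:R * l ^+ 2)) <=
  Ex p (fun t => expR (l * (- (dH t (nearest A a0 t))%:R - Ex p (fun t => - (dH t (nearest A a0 t))%:R)))).
  apply: (@le_trans _ _ (expR (l * m) * Ex p (fun t => (A t)%:R))).
    by rewrite ler_wpM2l ?expR_ge0.
  rewrite -ExZ; apply: le_Ex => // t; case At : (A t); last first.
    by rewrite mulr0 expR_ge0.
  rewrite mulr1 ler_expR ExN -/m.
  have : (dH t (nearest A a0 t) <= 0)%N by rewrite -(dHxx t) nearest_min.
  by rewrite leqn0 => /eqP ->; rewrite oppr0 sub0r opprK.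
move=> /(le_trans H); rewrite -expRD ler_expR => {}H.
by rewrite -(ler_pM2l l0); lra.
Qed.

(** The laws are exchanged one coordinate at a time; each coordinate marked by [k] moves the mean of
    a Lipschitz function by at most 1. *)
Lemma Ex_change n T (p q : 'I_n -> T -> R) f :
  (forall i, is_pmf (p i)) -> (forall i, is_pmf (q i)) -> lip f ->
  forall k : {ffun 'I_n -> bool}, (forall i, ~~ k i -> p i = q i) ->
  Ex p f <= Ex q f + (\sum_i k i)%N%:R.
Proof.
elim: n p q f => [|n IH] p q f pp qq lf k pq.
  by rewrite !Ex_ord0 lerDl ler0n.
rewrite !Ex_cons big_ord_recl natrD.
set q' := fun j => q (lift ord0 j); pose g a := Ex q' (fun t => f (fcons a t)).
apply: (@le_trans _ _ (\sum_a p ord0 a * (g a + (\sum_(i < n) k (lift ord0 i))%N%:R))).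
  apply: ler_sum => a _; rewrite ler_wpM2l ?(pp _).1 //.
  have /= := IH (fun j => p (lift ord0 j)) q' (fun t => f (fcons a t)) _ _ _
    [ffun j => k (lift ord0 j)].
  under eq_bigr do rewrite ffunE.
  apply=> [i|i|s t|i]; [exact: pp|exact: qq| |].
    by apply: (le_trans (lf _ _)); rewrite dH_cons eqxx.
  by rewrite ffunE => /pq.
under eq_bigr do rewrite mulrDr.
rewrite big_split /= -big_distrl /= (pp ord0).2 mul1r addrA lerD2r -/q'.
have [k0|k0] := boolP (k ord0); last first.
  by rewrite addr0 (pq _ k0).
(* The two laws of the first coordinate are compared through independent draws from both. *)
have : \sum_a \sum_b (p ord0 a * q ord0 b) * (g a - g b) <= 1.
  apply: (@le_trans _ _ (\sum_a \sum_b (p ord0 a * q ord0 b) * 1)).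
    apply: ler_sum => a _; apply: ler_sum => b _; rewrite ler_wpM2l //.
      by rewrite mulr_ge0 ?(pp _).1 ?(qq _).1.
    by apply: (le_trans (Ex_lip qq lf a b)); rewrite lern1 leq_b1.
  under eq_bigr do rewrite -big_distrl /= -big_distrr /= (qq ord0).2 !mulr1.
  by rewrite (pp ord0).2.
rewrite (_ : \sum_a _ = \sum_a p ord0 a * g a - \sum_b q ord0 b * g b).
  by rewrite lerBlDl.
rewrite -[X in X - _]mulr1 -[X in _ * X](qq ord0).2.
rewrite -[X in _ - X]mul1r -[X in _ - X * _](pp ord0).2 !big_distrlr /= -sumrB.
apply: eq_bigr => a _; rewrite -sumrB; apply: eq_bigr => b _; ring.
Qed.

(** Exponential Markov inequality: the weights b^dH factor over the coordinates, and each factor has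
    mean at most p(a_i) + b. This prices the enlargement of acceptance sets in false-alarm
    probability. *)
Lemma ball_growth T (p : T -> R) (e : R) : is_pmf p -> 0 < e ->
  exists2 r : R, 0 < r & forall n r' (a : {ffun 'I_n -> T}), r' <= r -> (forall i, 0 < p (a i)) ->
   Ex (fun=> p) (fun t => ((dH t a)%:R <= n%:R * r')%R%:R) <= expR (n%:R * e) * \prod_i p (a i).
Proof.
move=> [p0 p1] e0.
(* [k] bounds the positive masses from below; [b <= k * e / 2] then gives p(a_i) + b <= (1 + e/2)
   p(a_i). *)
have [k k0 kp] : exists2 k : R, 0 < k & forall a, 0 < p a -> k <= p a.
  pose k : R := \big[Num.min/1]_(a | 0 < p a) p a.
  exists k; first by rewrite /k; elim/big_ind: _ => // x y x0 y0; rewrite lt_min x0.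
  by move=> a pa; rewrite /k (bigD1 a) //= ge_min lexx.
pose b : R := Num.min (2^-1) (k * e / 2).
have b0 : 0 < b by rewrite lt_min invr_gt0 ltr0n divr_gt0 ?mulr_gt0.
have b2 : b <= 2^-1 by rewrite ge_min lexx.
have bk : b <= k * e / 2 by rewrite ge_min lexx orbT.
have lb : 0 < - ln b by rewrite oppr_gt0; apply: ln_lt0; rewrite b0 /=; lra.
(* With this radius b^dH is at least exp(-ne/2) on the ball; the other half of the exponent pays for
   the coordinate factors. *)
exists (e / 2 / - ln b) => [|n r' a rr' pa]; first by rewrite !divr_gt0.
set r := e / 2 / - ln b.
apply: (@le_trans _ _ (Ex (fun=> p) (fun t => expR (n%:R * (e / 2)) *
    \prod_i (b ^+ (t i != a i))))).
  apply: le_Ex => // t; rewrite prodrXr -/(dH t a).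
  case: (leP _ (n%:R * r')) => /= [H|_]; last by rewrite mulr_ge0 ?expR_ge0 // exprn_ge0 // ltW.
  rewrite -[b]lnK // -expRM_natl -expRD; apply: ge1_expR.
  have : (dH t a)%:R * - ln b <= n%:R * r * - ln b.
    by rewrite ler_pM2r // (le_trans H) // ler_wpM2l.
  rewrite -mulrA /r divfK ?gt_eqF //; lra.
rewrite ExZ (Ex_prod _ (fun i x => b ^+ (x != a i))).
rewrite (_ : n%:R * e = n%:R * (e / 2) + n%:R * (e / 2)); last by field.
rewrite expRD -mulrA ler_wpM2l ?expR_ge0 //.
rewrite expRM_natl -[in X in _ <= X * _](card_ord n) -prodr_const -big_split /=.
apply: ler_prod => i _; apply/andP; split.
  by apply: sumr_ge0 => x _; rewrite mulr_ge0 // exprn_ge0 // ltW.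
apply: (@le_trans _ _ (p (a i) + b)).
  rewrite (bigD1 (a i)) //= eqxx mulr1 lerD2l.
  apply: (@le_trans _ _ (\sum_(x | x != a i) p x * b)).
    by apply: ler_sum => x ->; rewrite expr1.
  rewrite -big_distrl /= -[leRHS]mul1r ler_wpM2r ?(ltW b0) //.
  by rewrite -p1 [leRHS](bigD1 (a i)) //= lerDr.
have e2 : 1 + e / 2 <= expR (e / 2) by apply: expR_ge1Dx.
have kpi := kp _ (pa i).
apply: (@le_trans _ _ ((1 + e / 2) * p (a i))); last by rewrite ler_wpM2r.
rewrite mulrDl mul1r lerD2l (le_trans bk) //.
by rewrite -mulrA mulrC ler_wpM2l // divr_ge0 ?ltW.
Qed.
End Concentration.

(** * Sums of independent coordinates and random sampling *)

Section Sampling.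
Variable R : realType.
Implicit Types I T : finType.

Lemma Ex_coord I T (p : I -> T -> R) i (phi : T -> R) : (forall i, is_pmf (p i)) ->
  Ex p (fun t => phi (t i)) = \sum_a p i a * phi a.
Proof.
move=> pp.
transitivity (Ex p (fun t => \prod_j (if j == i then phi (t j) else 1))).
  apply: eq_Ex => t; rewrite (bigD1 i) //= eqxx big1 ?mulr1 //.
  by move=> j /negbTE ->.
rewrite (Ex_prod p (fun j a => if j == i then phi a else 1)) (bigD1 i) //= eqxx.
rewrite [X in _ * X]big1 ?mulr1 // => j /negbTE ->.
by under eq_bigr do rewrite mulr1; apply: (pp j).2.
Qed.

Lemma Ex_sum_coord I T (p : I -> T -> R) (phi : I -> T -> R) :
  (forall i, is_pmf (p i)) ->
  Ex p (fun t => \sum_i phi i (t i)) = \sum_i \sum_a p i a * phi i a.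
Proof.
move=> pp; rewrite (Ex_sum p xpredT (fun i t => phi i (t i))).
by apply: eq_bigr => i _; rewrite (Ex_coord i (phi i)).
Qed.

Lemma lip_sum I T (phi : I -> T -> R) : (forall i a b, phi i a - phi i b <= 1) ->
  lip (fun t => \sum_i phi i (t i)).
Proof.
move=> H s t; rewrite -sumrB /dH natr_sum; apply: ler_sum => i _.
by case: eqVneq => [->|_]; rewrite ?subrr.
Qed.

(** Discarding null sequences is what later allows [ball_growth], whose centres must have positive
    letters. *)
Lemma Ex_supp I T (p : I -> T -> R) F : (forall i, is_pmf (p i)) ->
  Ex p F = Ex p (fun t => [forall i, 0 < p i (t i)]%:R * F t).
Proof.
move=> pp; apply: eq_bigr => t _; rewrite mulrA.
case: (boolP [forall i, 0 < p i (t i)]) => [_|]; first by rewrite mulr1.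
rewrite negb_forall => /existsP[i]; rewrite lt0r (pp i).1 andbT negbK => /eqP pi.
by rewrite (bigD1 i) //= pi !mul0r.
Qed.

Lemma scaled_le1 (C a b : R) : 0 < C -> a <= C -> 0 <= b -> a / C - b / C <= 1.
Proof. by move=> C0 aC b0; rewrite -mulrBl ler_pdivrMr // mul1r; lra. Qed.

Lemma uniform_pmf n : (0 < n)%N -> is_pmf (fun _ : 'I_n => n%:R^-1 : R).
Proof.
move=> n0; split=> [x|]; first by rewrite invr_ge0.
by rewrite sumr_const card_ord -[LHS]mulr_natr mulVf // pnatr_eq0 -lt0n.
Qed.

(** Both tails of the sum of [g / C] over draws with replacement. It lets a few stored positions of
    y estimate the cost of a whole reproduction. *)
Lemma sampling n m (g : 'I_n -> R) (C e : R) : (0 < n)%N -> 0 < C ->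
  (forall i, 0 <= g i <= C) -> 0 <= e <= 2 ->
  Ex (fun (_ : 'I_m) (_ : 'I_n) => n%:R^-1)
    (fun u => (m%:R * e * C <= `|\sum_j g (u j) - m%:R / n%:R * \sum_i g i|)%R%:R)
  <= 2 * expR (- (m%:R * e ^+ 2 / 8)).
Proof.
move=> n0 C0 gC e2; pose p := fun (_ : 'I_m) (_ : 'I_n) => n%:R^-1 : R.
have pp i : is_pmf (p i) by apply: uniform_pmf.
pose phi := fun (_ : 'I_m) i => g i / C.
have lf : lip (fun u : {ffun 'I_m -> 'I_n} => \sum_j phi j (u j)).
  apply: lip_sum => j a b; apply: scaled_le1 => //.
    by have /andP[] := gC a.
  by have /andP[] := gC b.
have E : Ex p (fun u => \sum_j phi j (u j)) = m%:R / n%:R * (\sum_i g i) / C.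
  rewrite Ex_sum_coord // /phi; under eq_bigr do rewrite -big_distrr -big_distrl /=.
  by rewrite sumr_const card_ord -[LHS]mulr_natl !mulrA.
have H1 := tail_upper pp lf e2; have H2 := tail_lower pp lf e2.
rewrite mulr2n mulrDl mul1r; apply: le_trans (lerD H1 H2).
rewrite -ExD; apply: le_Ex => // u; rewrite E -natrD ler_nat.
rewrite -big_distrl /=; set S := \sum_j _; set M := _ * \sum_i _.
rewrite -(ler_pM2r C0 (M / C + _)) -(ler_pM2r C0 (S / C)) mulrDl mulrBl !divfK ?gt_eqF //.
case: leP => //=; case: (lerP 0 (S - M)) => H.
  by rewrite ger0_norm // => ?; rewrite (_ : (M + _ <= S) = true) //; lra.
by rewrite ltr0_norm // => ?; rewrite (_ : (S <= M - _) = true) ?addn1 //; lra.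
Qed.
End Sampling.

(** * Turning a rarely successful block code into a reliable one *)

Lemma eq_imp_le (R : realType) (a b : R) : a = b -> a <= b.
Proof. by move=> ->. Qed.

Section Block.
Variable R : realType.
Variables (X Y Z Xh : finType) (PY : Y -> R) (W : Y -> Z -> R)
  (V : Y -> Z -> X -> R) (d : X -> Xh -> R) (C : R).
Hypotheses (PYp : is_pmf PY) (Wp : is_channel W) (Vp : forall y z, is_pmf (V y z)).
Hypotheses (C0 : 0 < C) (dC : forall x xh, 0 <= d x xh <= C).

Definition outlaw (z : Z) : R := \sum_y PY y * W y z.

Lemma outlaw_pmf : is_pmf outlaw.
Proof.
split=> [z|]; first by apply: sumr_ge0 => y _; rewrite mulr_ge0 ?PYp.1 ?(Wp y).1.
rewrite exchange_big /= -PYp.2; apply: eq_bigr => y _.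
by rewrite -big_distrr /= (Wp y).2 mulr1.
Qed.

Lemma outlaw_gt0 y z : 0 < PY y -> 0 < W y z -> 0 < outlaw z.
Proof.
move=> y0 w0; apply: (@lt_le_trans _ _ (PY y * W y z)); first exact: mulr_gt0.
rewrite /outlaw (bigD1 y) //= lerDl; apply: sumr_ge0 => y' _.
by rewrite mulr_ge0 ?PYp.1 ?(Wp y').1.
Qed.

(** Neither the encoder nor the decoder sees x, so distortion is handled through its conditional
    mean given y and z. *)
Definition ccost (y : Y) (z : Z) (xh : Xh) : R := \sum_x V y z x * d x xh.

Lemma ccost_bound y z xh : 0 <= ccost y z xh <= C.
Proof.
apply/andP; split.
  by apply: sumr_ge0 => x _; rewrite mulr_ge0 ?(Vp y z).1 //; have /andP[] := dC x xh.
rewrite -[leRHS]mul1r -(Vp y z).2 big_distrl; apply: ler_sum => x _ /=.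
by rewrite ler_wpM2l ?(Vp y z).1 //; have /andP[] := dC x xh.
Qed.

Definition cost n (y : {ffun 'I_n -> Y}) (z : {ffun 'I_n -> Z}) (xh : {ffun 'I_n -> Xh}) : R :=
  \sum_i ccost (y i) (z i) (xh i).

Lemma cost_le n y z xh : @cost n y z xh <= n%:R * C.
Proof.
apply: (@le_trans _ _ (\sum_(i < n) C)).
  by apply: ler_sum => i _; have /andP[] := ccost_bound (y i) (z i) (xh i).
by rewrite sumr_const card_ord -[leLHS]mulr_natl.
Qed.

Lemma cost_change n y z y' z' xh :
  @cost n y z xh <= cost y' z' xh + C * ((dH y y')%:R + (dH z z')%:R).
Proof.
rewrite /cost /dH -natrD -big_split natr_sum big_distrr -big_split /=.
apply: ler_sum => i _.
have /andP[_ c1] := ccost_bound (y i) (z i) (xh i).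
have /andP[c2 _] := ccost_bound (y' i) (z' i) (xh i).
case: (eqVneq (y i)) c1 => [->|_] c1; last first.
  by rewrite (le_trans c1) // natrD mulrDr mulr1 addrCA lerDl addr_ge0 // mulr_ge0 // ltW.
case: eqVneq => [->|_]; first by rewrite mulr0 addr0.
by rewrite (le_trans c1) // mulr1 lerDr.
Qed.

Lemma Ex_dist n (y : {ffun 'I_n -> Y}) (z : {ffun 'I_n -> Z}) (xh : {ffun 'I_n -> Xh}) :
  Ex (fun i => V (y i) (z i)) (fun x => avg_dist d x xh) = cost y z xh / n%:R.
Proof.
rewrite /avg_dist ExZr (Ex_sum_coord (fun i x => d x (xh i))) //.
Qed.

(** Given y and z the distortion is a sum of independent terms with mean [cost]; if that mean
    exceeds nD by more than neC, distortion at most D is a lower-tail deviation. *)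
Lemma dist_concentration n (y : {ffun 'I_n -> Y}) (z : {ffun 'I_n -> Z}) (xh : {ffun 'I_n -> Xh}) (D e : R) : (0 < n)%N ->
  0 <= e <= 2 ->
  Ex (fun i => V (y i) (z i)) (fun x => (avg_dist d x xh <= D)%R%:R) <=
  (cost y z xh <= n%:R * (D + e * C))%R%:R + expR (- (n%:R * e ^+ 2 / 8)).
Proof.
move=> n0 e2; have n0' : 0 < n%:R :> R by rewrite ltr0n.
case: (leP (cost y z xh)) => [_|H].
  rewrite -[leLHS]addr0 lerD ?expR_ge0 //.
  rewrite -[leRHS](Ex_const _ (fun i => Vp (y i) (z i))); apply: le_Ex => // x.
  by rewrite ler_nat leq_b1.
rewrite add0r.
pose phi (i : 'I_n) x := d x (xh i) / C.
have lf : lip (fun x : {ffun 'I_n -> X} => \sum_j phi j (x j)).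
  apply: lip_sum => j a b; apply: scaled_le1 => //.
    by have /andP[] := dC a (xh j).
  by have /andP[] := dC b (xh j).
have pp i : is_pmf (V (y i) (z i)) by [].
apply: le_trans (tail_lower pp lf e2); apply: le_Ex => // x.
rewrite ler_nat; case: (leP (avg_dist d x xh)) => //= H'.
rewrite (_ : (_ <= _)%R = true) // Ex_sum_coord //.
rewrite (_ : \sum_i _ = cost y z xh / C); last first.
  by rewrite big_distrl; apply: eq_bigr => i _; rewrite big_distrl; apply: eq_bigr => a _; rewrite mulrA.
rewrite /phi -big_distrl /= lerBrDr -(ler_pM2r C0) mulrDl !divfK ?gt_eqF //.
move: H'; rewrite /avg_dist ler_pdivrMr // => H'; lra.
Qed.

(** * Good pairs of a block and the code built from them *)

Section Core.
Variables (n m : nat) (S : finType) (f : {ffun 'I_n -> Y} -> S)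
  (B : S -> {ffun 'I_n -> Z} -> bool) (h : S -> {ffun 'I_n -> Z} -> {ffun 'I_n -> Xh}).
Variables (D b e e1 r l : R).
Hypotheses (n0 : (0 < n)%N) (e2 : 0 <= e <= 2) (r0 : 0 < r) (l2 : 0 < l <= 2^-1)
  (le : l ^+ 2 <= e ^+ 2 / 8) (D0 : 0 <= D).
Hypothesis growY : forall a : {ffun 'I_n -> Y}, (forall i, 0 < PY (a i)) ->
   Ex (fun=> PY) (fun t => ((dH t a)%:R <= n%:R * r)%R%:R) <= expR (n%:R * e1) * \prod_i PY (a i).
Hypothesis growZ : forall a : {ffun 'I_n -> Z}, (forall i, 0 < outlaw (a i)) ->
   Ex (fun=> outlaw) (fun t => ((dH t a)%:R <= n%:R * r)%R%:R) <= expR (n%:R * e1) * \prod_i outlaw (a i).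
Hypothesis ballZ : forall a : {ffun 'I_n -> Z},
   \sum_t ((dH t a)%:R <= n%:R * r)%R%:R <= expR (n%:R * e1).

Hypothesis success : 3 * expR (- (n%:R * l ^+ 2)) <=
  Ex (fun=> PY) (fun y => Ex (fun i => W (y i)) (fun z => (B (f y) z)%:R *
    Ex (fun i => V (y i) (z i)) (fun x => (avg_dist d x (h (f y) z) <= D)%R%:R))).
Hypothesis false_alarm :
  Ex (fun=> PY) (fun y => Ex (fun=> outlaw) (fun z => (B (f y) z)%:R)) <= b.

(** Positivity of the letters is included so that good sequences qualify as centres in the ball
    bounds. *)
Let G (y : {ffun 'I_n -> Y}) (z : {ffun 'I_n -> Z}) : bool :=
  [&& [forall i, 0 < PY (y i)], [forall i, 0 < W (y i) (z i)], B (f y) z &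
      (cost y z (h (f y) z) <= n%:R * (D + e * C))%R].

Let th : R := expR (- (n%:R * l ^+ 2)).

Let W_ (y : {ffun 'I_n -> Y}) := fun i => W (y i).
Let PYn := fun _ : 'I_n => PY.
Let PZn := fun _ : 'I_n => outlaw.

Let Wp_ y i : is_pmf (W_ y i). Proof. exact: Wp. Qed.
Let PYp_ i : is_pmf (PYn i). Proof. exact: PYp. Qed.
Let PZp_ i : is_pmf (PZn i). Proof. exact: outlaw_pmf. Qed.

(** Of a success probability of at least 3[th], pairs with too large a conditional cost contribute
    at most [th], because l^2 <= e^2/8. *)
Lemma good_mass : 2 * th <= Ex PYn (fun y => Ex (W_ y) (fun z => (G y z)%:R)).
Proof.
have H : Ex PYn (fun y => Ex (W_ y) (fun z => (B (f y) z)%:R *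
    Ex (fun i => V (y i) (z i)) (fun x => (avg_dist d x (h (f y) z) <= D)%R%:R))) <=
  Ex PYn (fun y => Ex (W_ y) (fun z => (G y z)%:R)) + th.
  rewrite Ex_supp // [X in _ <= X + _]Ex_supp // -[X in _ + X](Ex_const _ PYp_) -ExD.
  apply: le_Ex => // y.
  case: (boolP [forall i, 0 < PYn i (y i)]) => yp; last by rewrite !mul0r add0r expR_ge0.
  rewrite !mul1r Ex_supp // [X in _ <= X + _]Ex_supp //.
  rewrite -[X in _ + X](Ex_const _ (Wp_ y)) -ExD.
  apply: le_Ex => // z.
  case: (boolP [forall i, 0 < W_ y i (z i)]) => zp; last by rewrite !mul0r add0r expR_ge0.
  rewrite !mul1r /G yp zp /=; case: (B (f y) z) => /=; last by rewrite mul0r add0r expR_ge0.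
  rewrite mul1r (le_trans (dist_concentration _ _ _ _ n0 e2)) //.
  by rewrite lerD2l /th ler_expR lerN2 -mulrA ler_wpM2l.
have := le_trans success H; rewrite -/th; lra.
Qed.

Let A y := th <= Ex (W_ y) (fun z => (G y z)%:R).

(** Sequences outside [A] contribute at most [th] to the good mass 2[th]. *)
Lemma A_mass : th <= Ex PYn (fun y => (A y)%:R).
Proof.
have : Ex PYn (fun y => Ex (W_ y) (fun z => (G y z)%:R)) <= Ex PYn (fun y => (A y)%:R) + th.
  rewrite -[X in _ + X](Ex_const _ PYp_) -ExD; apply: le_Ex => // y.
  case: (leP th (Ex (W_ y) (fun z => (G y z)%:R))) => H.
    rewrite /A H -[leLHS]addr0 lerD ?expR_ge0 //.
    by rewrite -[leRHS](Ex_const _ (Wp_ y)); apply: le_Ex => // z; rewrite ler_nat leq_b1.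
  by rewrite (le_trans (ltW H)) // lerDr.
by move=> /(le_trans good_mass); lra.
Qed.

Lemma A_nonempty : exists y, A y.
Proof.
have [y Ay|N] := pickP A; first by exists y.
have := A_mass; under eq_Ex do rewrite N.
by rewrite Ex_const // leNgt expR_gt0.
Qed.

Lemma G_nonempty y : A y -> exists z, G y z.
Proof.
move=> Ay; have [z Gz|N] := pickP (G y); first by exists z.
have := Ay; rewrite /A; under eq_Ex do rewrite N.
by rewrite Ex_const // leNgt expR_gt0.
Qed.

Section Coder.
Variables (y0 : {ffun 'I_n -> Y}) (z0 : {ffun 'I_n -> Y} -> {ffun 'I_n -> Z}).
Hypotheses (Ay0 : A y0) (Gz0 : forall y, A y -> G y (z0 y)).

Let yt (y : {ffun 'I_n -> Y}) := nearest A y0 y.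
Let zt y (z : {ffun 'I_n -> Z}) := nearest (G y) (z0 y) z.

Let Ayt y : A (yt y). Proof. exact: nearestP. Qed.
Let Gzt y z : G (yt y) (zt (yt y) z). Proof. by apply: nearestP; apply: Gz0. Qed.

Let nR0 : 0 < n%:R :> R. Proof. by rewrite ltr0n. Qed.
Let nr0 : 0 < n%:R * r. Proof. exact: mulr_gt0. Qed.

Lemma near_y_mean : Ex PYn (fun y => (dH y (yt y))%:R) <= 3 * n%:R * l.
Proof. by apply: blowup => //; apply: A_mass. Qed.

(** Under the channel with input [yt y] blowing-up gives 3nl; returning to the input [y] costs the
    distance from [y] to [yt y], whose mean is another 3nl. *)
Lemma near_z_mean :
  Ex PYn (fun y => Ex (W_ y) (fun z => (dH z (zt (yt y) z))%:R)) <= 6 * n%:R * l.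
Proof.
apply: (@le_trans _ _ (Ex PYn (fun y => 3 * n%:R * l + (dH y (yt y))%:R))); last first.
  by rewrite ExD Ex_const //; have := near_y_mean; lra.
apply: le_Ex => // y.
have lz : lip (fun z => (dH z (zt (yt y) z))%:R : R).
  by apply: lip_nearest; apply: Gz0.
have := Ex_change (Wp_ y) (Wp_ (yt y)) lz (k := [ffun i => y i != yt y i]).
under eq_bigr do rewrite ffunE.
move=> /(_ _)/le_trans; apply=> [i|].
  by rewrite ffunE negbK /W_ => /eqP ->.
by rewrite lerD2r; apply: blowup; [exact: Wp_| |apply: Gz0|apply: Ayt].
Qed.

Let nearY y := ((dH y (yt y))%:R <= n%:R * r)%R.
(** Only conditions that the decoder can check from the message and z are allowed here, so goodness
    of the pair is not among them. *)
Let cand s (z z' : {ffun 'I_n -> Z}) :=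
  [&& ((dH z z')%:R <= n%:R * r)%R, B s z' & [forall i, 0 < outlaw (z' i)]].
Let B1 (s : option S * {ffun 'I_m -> Y}) z :=
  if s.1 is Some s1 then [exists z', cand s1 z z'] else false.
(* [None] flags a y far from every good sequence; the second component samples
   y at the positions u, which lets the decoder estimate distortions. *)
Let F (u : {ffun 'I_m -> 'I_n}) y : option S * {ffun 'I_m -> Y} :=
  (if nearY y then Some (f (yt y)) else None, [ffun j => y (u j)]).
Let scost (u : {ffun 'I_m -> 'I_n}) (t : {ffun 'I_m -> Y}) (z : {ffun 'I_n -> Z})
  (xh : {ffun 'I_n -> Xh}) := \sum_j ccost (t j) (z (u j)) (xh (u j)).
(** The fallbacks [z] and [h (f y0) z] serve when there is no candidate or no message; the
    distortion is then bounded by [C]. *)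
Let H (u : {ffun 'I_m -> 'I_n}) (s : option S * {ffun 'I_m -> Y}) z :=
  if s.1 is Some s1 then
    h s1 (if [pick z' | cand s1 z z'] is Some z1
          then [arg min_(z' < z1 | cand s1 z z') scost u s.2 z (h s1 z')]%O else z)
  else h (f y0) z.
(** All z' of the ball are covered, because the candidate selected by [H] depends on the sample
    [u]. *)
Let bad (u : {ffun 'I_m -> 'I_n}) (y : {ffun 'I_n -> Y}) (z : {ffun 'I_n -> Z}) :=
  [exists z', ((dH z z')%:R <= n%:R * r)%R &&
    (m%:R * e * C <= `|scost u [ffun j => y (u j)] z (h (f (yt y)) z') -
       m%:R / n%:R * cost y z (h (f (yt y)) z')|)%R].

Let cand_zt y z : ((dH z (zt (yt y) z))%:R <= n%:R * r)%R ->
  cand (f (yt y)) z (zt (yt y) z).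
Proof.
move=> Hz; rewrite /cand Hz; have /and4P[/forallP py /forallP wz -> _] := Gzt y z.
by apply/forallP => i; apply: (outlaw_gt0 (py i) (wz i)).
Qed.

(** Markov's inequality: rejection requires y or z to be farther than nr from its nearest good
    sequence, and the two mean distances add up to at most 9nl. *)
Lemma coder_accepts u :
  1 - 9 * l / r <= Ex PYn (fun y => Ex (W_ y) (fun z => (B1 (F u y) z)%:R)).
Proof.
have H1 : 1 <= Ex PYn (fun y => Ex (W_ y) (fun z => (B1 (F u y) z)%:R) +
    ((dH y (yt y))%:R + Ex (W_ y) (fun z => (dH z (zt (yt y) z))%:R)) / (n%:R * r)).
  rewrite -[leLHS](Ex_const _ PYp_); apply: le_Ex => // y.
  rewrite -[leLHS](Ex_const _ (Wp_ y)) -[(dH y (yt y))%:R](Ex_const _ (Wp_ y)).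
  rewrite -ExD -ExZr -ExD; apply: le_Ex => // z.
  have [ny|ny] := boolP (nearY y); last first.
    rewrite -[leLHS]add0r lerD // ler_pdivlMr // mul1r.
    by rewrite -[leLHS]addr0 lerD // ltW // ltNge.
  case: (leP ((dH z (zt (yt y) z))%:R) (n%:R * r)) => nz; last first.
    rewrite -[leLHS]add0r lerD // ler_pdivlMr // mul1r.
    by rewrite -[leLHS]add0r lerD // ltW // ltNge.
  rewrite (_ : B1 _ _ = true) ?lerDl ?divr_ge0 ?addr_ge0 ?(ltW nr0) //.
  by rewrite /B1 /F ny /=; apply/existsP; exists (zt (yt y) z); apply: cand_zt.
move: H1; rewrite ExD ExZr ExD => H1.
have H2 : (Ex PYn (fun y => (dH y (yt y))%:R) +
  Ex PYn (fun y => Ex (W_ y) (fun z => (dH z (zt (yt y) z))%:R))) / (n%:R * r) <= 9 * l / r.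
  rewrite ler_pdivrMr // (_ : 9 * l / r * _ = 9 * n%:R * l); last first.
    by field; rewrite gt_eqF.
  by have := near_y_mean; have := near_z_mean; lra.
lra.
Qed.

Lemma coder_false_alarm u :
  Ex PYn (fun y => Ex PZn (fun z => (B1 (F u y) z)%:R)) <= expR (2 * n%:R * e1) * b.
Proof.
pose py (y : {ffun 'I_n -> Y}) := [forall i, 0 < PY (y i)].
pose pz (z : {ffun 'I_n -> Z}) := [forall i, 0 < outlaw (z i)].
(* Union bound over the pairs accepted by [B] whose balls contain y and z; acceptance by [B1]
   provides such a pair with y' = [yt y]. *)
apply: (@le_trans _ _ (Ex PYn (fun y => Ex PZn (fun z =>
  \sum_(y' | py y') \sum_(z' | pz z') (B (f y') z')%:R *
    (((dH y y')%:R <= n%:R * r)%R%:R * ((dH z z')%:R <= n%:R * r)%R%:R))))).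
  apply: le_Ex => // y; apply: le_Ex => // z.
  have T0 y' z' : 0 <= (B (f y') z')%:R *
    (((dH y y')%:R <= n%:R * r)%R%:R * ((dH z z')%:R <= n%:R * r)%R%:R) :> R.
    by rewrite !mulr_ge0.
  rewrite /B1 /F /=; have [ny|ny] := boolP (nearY y); last first.
    by apply: sumr_ge0 => y' _; apply: sumr_ge0.
  case: existsP => [[z' /and3P[nz Bz pz']]|_]; last first.
    by apply: sumr_ge0 => y' _; apply: sumr_ge0.
  have pyt : py (yt y) by have /and4P[] := Gzt y z.
  rewrite (bigD1 (yt y)) //= (bigD1 z') //= Bz nz -/(nearY y) ny !mulr1.
  rewrite -addrA lerDl addr_ge0 //; first by apply: sumr_ge0.
  by apply: sumr_ge0 => y' _; apply: sumr_ge0.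
(* Each ball probability is exchanged for exp(n e1) times the mass of its centre, which rebuilds the
   false-alarm probability of [B]. *)
apply: (@le_trans _ _ (\sum_(y' | py y') \sum_(z' | pz z') (B (f y') z')%:R *
  ((expR (n%:R * e1) * \prod_i PY (y' i)) * (expR (n%:R * e1) * \prod_i outlaw (z' i))))).
  rewrite (eq_Ex _ (fun y => Ex_sum _ _ (fun y' z => \sum_(z' | pz z') (B (f y') z')%:R *
    (((dH y y')%:R <= n%:R * r)%R%:R * ((dH z z')%:R <= n%:R * r)%R%:R)))).
  rewrite Ex_sum; apply: ler_sum => y' hy'.
  rewrite (eq_Ex _ (fun y => Ex_sum _ _ (fun z' z => (B (f y') z')%:R *
    (((dH y y')%:R <= n%:R * r)%R%:R * ((dH z z')%:R <= n%:R * r)%R%:R)))).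
  rewrite Ex_sum; apply: ler_sum => z' hz'.
  rewrite (eq_Ex _ (fun y => ExZ _ _ _)) ExZ ler_wpM2l //.
  rewrite (eq_Ex _ (fun y => ExZ _ _ _)) ExZr; apply: ler_pM.
  - exact: Ex_ge0.
  - exact: Ex_ge0.
  - by apply: growY; apply/forallP.
  - by apply: growZ; apply/forallP.
rewrite (_ : expR (2 * n%:R * e1) = expR (n%:R * e1) * expR (n%:R * e1)); last first.
  by rewrite -expRD; congr expR; ring.
apply: (@le_trans _ _ (expR (n%:R * e1) * expR (n%:R * e1) *
    Ex PYn (fun y => Ex PZn (fun z => (B (f y) z)%:R)))); last first.
  by rewrite ler_wpM2l // mulr_ge0 ?expR_ge0.
rewrite /Ex big_distrr big_mkcond; apply: ler_sum => y _ /=.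
have q0 : 0 <= \prod_i PYn i (y i) by apply: prodr_ge0 => i _; apply: (PYp_ i).1.
have z0' (z : {ffun 'I_n -> Z}) : 0 <= \prod_i PZn i (z i) by apply: prodr_ge0 => i _; apply: (PZp_ i).1.
case: ifP => _; last first.
  rewrite !mulr_ge0 ?expR_ge0 //; apply: sumr_ge0 => z _; exact: mulr_ge0.
rewrite mulrCA -mulrA !big_distrr big_mkcond; apply: ler_sum => z _ /=.
rewrite /PYn /PZn in q0 z0' *; case: ifP => _; last by rewrite !mulr_ge0 ?expR_ge0.
by apply: eq_imp_le; ring.
Qed.

(** If y or z is far or the sample is bad, the trivial bound nC applies. Otherwise 3e consists of e
    from the good pair and 2e from two estimation errors, and 2rC pays for moving from the good pair
    to y and z. *)
Lemma coder_cost u y z : (0 < m)%N ->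
  cost y z (H u (F u y) z) <= n%:R * (D + 3 * e * C + 2 * r * C) +
    n%:R * C * (((dH y (yt y))%:R + (dH z (zt (yt y) z))%:R) / (n%:R * r) + (bad u y z)%:R).
Proof.
move=> m0; have mR0 : 0 < m%:R :> R by rewrite ltr0n.
have [e0 _] := andP e2.
have T0 : 0 <= n%:R * (D + 3 * e * C + 2 * r * C).
  by rewrite mulr_ge0 // !addr_ge0 ?mulr_ge0 // ltW.
have nC0 : 0 < n%:R * C by rewrite mulr_gt0.
have trivial_case (v : R) : 1 <= v ->
    cost y z (H u (F u y) z) <= n%:R * (D + 3 * e * C + 2 * r * C) + n%:R * C * v.
  move=> v1; rewrite (le_trans (cost_le _ _ _)) // -[leLHS]add0r lerD //.
  by rewrite ler_peMr // ltW.
have [ny|ny] := boolP (nearY y); last first.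
  apply: trivial_case; rewrite -[leLHS]addr0 lerD // ler_pdivlMr // mul1r.
  by rewrite -[leLHS]addr0 lerD // ltW // ltNge.
case: (leP ((dH z (zt (yt y) z))%:R) (n%:R * r)) => nz; last first.
  apply: trivial_case; rewrite -[leLHS]addr0 lerD // ler_pdivlMr // mul1r.
  by rewrite -[leLHS]add0r lerD // ltW // ltNge.
have [hb|hb] := boolP (bad u y z).
  by apply: trivial_case; rewrite lerDr divr_ge0 ?addr_ge0 // ltW.
rewrite -[leLHS]addr0 lerD //; last first.
  by rewrite mulr_ge0 ?(ltW nC0) // addr_ge0 // divr_ge0 ?addr_ge0 // ltW.
have ct := cand_zt nz.
rewrite /H /F ny /=; set s := f (yt y) in ct *; set t := [ffun j => y (u j)].
case: pickP => [z1 cz1|/(_ (zt (yt y) z))]; last by rewrite ct.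
case: Order.TotalTheory.arg_minP => //= z2 cz2 /(_ _ ct) Hmin.
have ok z' : (dH z z')%:R <= n%:R * r ->
    `|scost u t z (h s z') - m%:R / n%:R * cost y z (h s z')| < m%:R * e * C.
  move=> Hz'; rewrite ltNge; apply/negP => Hbad; case/negP: hb.
  by apply/existsP; exists z'; rewrite Hz'.
have /and3P[/ok + _ _] := cz2; have /ok := nz.
rewrite !ltr_norml => /andP[_ k1] /andP[k2 _].
have k3 : m%:R / n%:R * cost y z (h s z2) <=
    m%:R / n%:R * cost y z (h s (zt (yt y) z)) + 2 * (m%:R * e * C) by lra.
have k4 : cost y z (h s z2) <= cost y z (h s (zt (yt y) z)) + 2 * n%:R * e * C.
  rewrite -(ler_pM2l (_ : 0 < m%:R / n%:R)) ?divr_gt0 //.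
  by apply: (le_trans k3); apply: eq_imp_le; field; rewrite gt_eqF.
have k5 := cost_change y z (yt y) (zt (yt y) z) (h s (zt (yt y) z)).
have /and4P[_ _ _ k6] := Gzt y z.
have k7 : C * ((dH y (yt y))%:R + (dH z (zt (yt y) z))%:R) <= C * (2 * (n%:R * r)).
  by rewrite ler_pM2l //; move: (ny); rewrite /nearY; lra.
rewrite -/s in k6; lra.
Qed.

(** Union bound over the at most exp(n e1) sequences of the ball, each treated by [sampling]. *)
Lemma sampling_bad y z :
  Ex (fun (_ : 'I_m) (_ : 'I_n) => n%:R^-1) (fun u => (bad u y z)%:R) <=
  2 * expR (n%:R * e1 - m%:R * e ^+ 2 / 8).
Proof.
pose pu := fun (_ : 'I_m) (_ : 'I_n) => n%:R^-1 : R.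
have pp i : is_pmf (pu i) by apply: uniform_pmf.
apply: (@le_trans _ _ (Ex pu (fun u => \sum_z' ((dH z' z)%:R <= n%:R * r)%R%:R *
   (m%:R * e * C <= `|scost u [ffun j => y (u j)] z (h (f (yt y)) z') -
       m%:R / n%:R * cost y z (h (f (yt y)) z')|)%R%:R))).
  apply: le_Ex => // u; rewrite /bad; case: existsP => [[z' /andP[h1 h2]]|_]; last first.
    by apply: sumr_ge0 => z' _; apply: mulr_ge0.
  rewrite (bigD1 z') //= h2 dHC h1 mulr1 lerDl; apply: sumr_ge0 => z2 _.
  exact: mulr_ge0.
rewrite Ex_sum.
apply: (@le_trans _ _ (\sum_z' ((dH z' z)%:R <= n%:R * r)%R%:R * (2 * expR (- (m%:R * e ^+ 2 / 8))))).
  apply: ler_sum => z' _; rewrite ExZ ler_wpM2l //.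
  have := @sampling _ n m (fun i => ccost (y i) (z i) (h (f (yt y)) z' i)) C e n0 C0 _ e2.
  move=> /(_ (fun i => ccost_bound _ _ _)); apply: le_trans; apply: le_Ex => // u.
  rewrite /scost /cost; under eq_bigr do rewrite ffunE.
  by [].
rewrite -big_distrl /= expRD mulrCA ler_wpM2l // ler_wpM2r ?expR_ge0 //.
Qed.

(** The bound is proved on average over uniformly random positions [u], and a favourable [u] is then
    fixed. *)
Lemma coder_distortion : (0 < m)%N ->
  exists u, Ex PYn (fun y => Ex (W_ y) (fun z => Ex (fun i => V (y i) (z i))
      (fun x => avg_dist d x (H u (F u y) z)))) <=
    D + 3 * e * C + 2 * r * C + C * (9 * l / r + 2 * expR (n%:R * e1 - m%:R * e ^+ 2 / 8)).
Proof.
move=> m0; set K := _ + C * _.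
pose pu := fun (_ : 'I_m) (_ : 'I_n) => n%:R^-1 : R.
have pp i : is_pmf (pu i) by apply: uniform_pmf.
pose J u := Ex PYn (fun y => Ex (W_ y) (fun z => Ex (fun i => V (y i) (z i))
      (fun x => avg_dist d x (H u (F u y) z)))).
suff HJ : Ex pu J <= K by exact: (Ex_exists_le pp HJ).
have -> : Ex pu J = Ex PYn (fun y => Ex (W_ y) (fun z => Ex pu (fun u =>
    cost y z (H u (F u y) z) / n%:R))).
  rewrite /J /Ex; under eq_bigr do rewrite big_distrr /=.
  rewrite exchange_big; apply: eq_bigr => y _ /=.
  rewrite big_distrr /=; under eq_bigr do rewrite mulrCA big_distrr big_distrr /=.
  rewrite exchange_big; apply: eq_bigr => z _ /=.
  rewrite !big_distrr; apply: eq_bigr => u _ /=.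
  rewrite -(Ex_dist y z) /Ex; ring.
pose q1 := 2 * expR (n%:R * e1 - m%:R * e ^+ 2 / 8).
apply: (@le_trans _ _ (Ex PYn (fun y => Ex (W_ y) (fun z =>
  (D + 3 * e * C + 2 * r * C) + C * (((dH y (yt y))%:R + (dH z (zt (yt y) z))%:R) / (n%:R * r) + q1))))).
  apply: le_Ex => // y; apply: le_Ex => // z.
  apply: (@le_trans _ _ (Ex pu (fun u => (D + 3 * e * C + 2 * r * C) +
     C * (((dH y (yt y))%:R + (dH z (zt (yt y) z))%:R) / (n%:R * r) + (bad u y z)%:R)))).
    apply: le_Ex => // u; rewrite ler_pdivrMr //.
    by apply: (le_trans (coder_cost u y z m0)); apply: eq_imp_le; ring.
  rewrite ExD Ex_const // lerD2l ExZ ler_pM2l // ExD Ex_const // lerD2l.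
  exact: sampling_bad.
rewrite (eq_Ex _ (fun y => ExD _ _ _)) ExD.
rewrite (eq_Ex _ (fun y => Ex_const _ (Wp_ y))) Ex_const // lerD2l.
rewrite (eq_Ex _ (fun y => ExZ _ _ _)) ExZ ler_pM2l //.
rewrite (eq_Ex _ (fun y => ExD _ _ _)) ExD.
rewrite (eq_Ex _ (fun y => Ex_const _ (Wp_ y))) Ex_const // lerD2r.
rewrite (eq_Ex _ (fun y => ExZr _ _ _)) ExZr (eq_Ex _ (fun y => ExD _ _ _)) ExD.
rewrite (eq_Ex _ (fun y => Ex_const _ (Wp_ y))).
rewrite ler_pdivrMr // (_ : 9 * l / r * _ = 9 * n%:R * l); last first.
  by field; rewrite gt_eqF.
by have := near_y_mean; have := near_z_mean; lra.
Qed.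
Lemma coder_exists : (0 < m)%N ->
  exists (F : {ffun 'I_n -> Y} -> option S * {ffun 'I_m -> Y})
    (B1 : option S * {ffun 'I_m -> Y} -> {ffun 'I_n -> Z} -> bool)
    (H : option S * {ffun 'I_m -> Y} -> {ffun 'I_n -> Z} -> {ffun 'I_n -> Xh}),
  [/\ 1 - 9 * l / r <=
        Ex (fun=> PY) (fun y => Ex (fun i => W (y i)) (fun z => (B1 (F y) z)%:R)),
      Ex (fun=> PY) (fun y => Ex (fun=> outlaw) (fun z => (B1 (F y) z)%:R)) <=
        expR (2 * n%:R * e1) * b &
      Ex (fun=> PY) (fun y => Ex (fun i => W (y i)) (fun z => Ex (fun i => V (y i) (z i))
        (fun x => avg_dist d x (H (F y) z)))) <=
      D + 3 * e * C + 2 * r * C + C * (9 * l / r + 2 * expR (n%:R * e1 - m%:R * e ^+ 2 / 8))].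
Proof.
move=> m0; have [u Hu] := coder_distortion m0.
exists (F u), B1, (H u); split; [exact: coder_accepts|exact: coder_false_alarm|exact: Hu].
Qed.
End Coder.

Lemma block_core : (0 < m)%N ->
  exists (F : {ffun 'I_n -> Y} -> option S * {ffun 'I_m -> Y})
    (B1 : option S * {ffun 'I_m -> Y} -> {ffun 'I_n -> Z} -> bool)
    (H : option S * {ffun 'I_m -> Y} -> {ffun 'I_n -> Z} -> {ffun 'I_n -> Xh}),
  [/\ 1 - 9 * l / r <=
        Ex (fun=> PY) (fun y => Ex (fun i => W (y i)) (fun z => (B1 (F y) z)%:R)),
      Ex (fun=> PY) (fun y => Ex (fun=> outlaw) (fun z => (B1 (F y) z)%:R)) <=
        expR (2 * n%:R * e1) * b &
      Ex (fun=> PY) (fun y => Ex (fun i => W (y i)) (fun z => Ex (fun i => V (y i) (z i))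
        (fun x => avg_dist d x (H (F y) z)))) <=
      D + 3 * e * C + 2 * r * C + C * (9 * l / r + 2 * expR (n%:R * e1 - m%:R * e ^+ 2 / 8))].
Proof.
move=> m0; have [y0 Ay0] := A_nonempty; have [z1 _] := G_nonempty Ay0.
pose z0 y := odflt z1 [pick z | G y z].
have Gz0 y : A y -> G y (z0 y).
  move=> /G_nonempty[z Gz]; rewrite /z0; case: pickP => //= /(_ z).
  by rewrite Gz.
exact: (coder_exists Ay0 Gz0 m0).
Qed.
End Core.
End Block.

(** * Choice of the constants in the block construction *)

Section BlockRefinement.
Variable R : realType.

Lemma pmf_inhabited (T : finType) (p : T -> R) : is_pmf p -> (0 < #|T|)%N.
Proof.
move=> [_ p1]; rewrite lt0n; apply/eqP => T0; move: p1.
by rewrite big1 => [/eqP|x _]; [rewrite eq_sym oner_eq0|have := fintype0 x T0].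
Qed.

(** This is [ball_growth] for the uniform law, multiplied by |T|^n. *)
Lemma ball_card (T : finType) (e : R) : (0 < #|T|)%N -> 0 < e ->
  exists2 r : R, 0 < r & forall n r' (a : {ffun 'I_n -> T}), r' <= r ->
   \sum_t ((dH t a)%:R <= n%:R * r')%R%:R <= expR (n%:R * e).
Proof.
move=> T0 e0; pose p (_ : T) : R := #|T|%:R^-1.
have N0 : 0 < #|T|%:R :> R by rewrite ltr0n.
have pp : is_pmf p.
  split=> [x|]; first by rewrite invr_ge0.
  by rewrite sumr_const -[LHS]mulr_natr mulVf // gt_eqF.
have [r r0 H] := ball_growth pp e0; exists r => // n r' a rr.
have pc (t : {ffun 'I_n -> T}) : \prod_i p (t i) = #|T|%:R^-1 ^+ n.
  by rewrite prodr_const card_ord.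
have pa i : 0 < p (a i) by rewrite invr_gt0.
have := H n r' a rr pa; rewrite pc.
have -> : Ex (fun=> p) (fun t => ((dH t a)%:R <= n%:R * r')%R%:R) =
    (\sum_t ((dH t a)%:R <= n%:R * r')%R%:R) * #|T|%:R^-1 ^+ n.
  by rewrite big_distrl; apply: eq_bigr => t _; rewrite pc mulrC.
by rewrite ler_pM2r // exprn_gt0 // invr_gt0.
Qed.

(** [del] and the threshold on n are chosen before the code, so that a single long block code can be
    refined. *)
Lemma block_lemma (X Y Z Xh : finType) (PY : Y -> R) (W : Y -> Z -> R)
  (V : Y -> Z -> X -> R) (d : X -> Xh -> R) (C g : R) :
  is_pmf PY -> is_channel W -> (forall y z, is_pmf (V y z)) ->
  0 < C -> (forall x xh, 0 <= d x xh <= C) -> 0 < g ->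
  exists2 del : R, 0 < del & exists N, forall n, (N <= n)%N ->
  forall (S : finType) (f : {ffun 'I_n -> Y} -> S)
    (B : S -> {ffun 'I_n -> Z} -> bool)
    (h : S -> {ffun 'I_n -> Z} -> {ffun 'I_n -> Xh}) (D b : R), 0 <= D ->
  expR (- (n%:R * del)) <=
  Ex (fun=> PY) (fun y => Ex (fun i => W (y i)) (fun z => (B (f y) z)%:R *
    Ex (fun i => V (y i) (z i)) (fun x => (avg_dist d x (h (f y) z) <= D)%R%:R))) ->
  Ex (fun=> PY) (fun y => Ex (fun=> outlaw PY W) (fun z => (B (f y) z)%:R)) <= b ->
  exists (S' : finType) (F : {ffun 'I_n -> Y} -> S')
    (B1 : S' -> {ffun 'I_n -> Z} -> bool)
    (H : S' -> {ffun 'I_n -> Z} -> {ffun 'I_n -> Xh}),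
  [/\ #|S'|%:R <= #|S|%:R * expR (n%:R * g),
      1 - g <=
        Ex (fun=> PY) (fun y => Ex (fun i => W (y i)) (fun z => (B1 (F y) z)%:R)),
      Ex (fun=> PY) (fun y => Ex (fun=> outlaw PY W) (fun z => (B1 (F y) z)%:R)) <=
        expR (n%:R * g) * b &
      Ex (fun=> PY) (fun y => Ex (fun i => W (y i)) (fun z => Ex (fun i => V (y i) (z i))
        (fun x => avg_dist d x (H (F y) z)))) <= D + g].
Proof.
move=> PYp Wp Vp C0 dC g0.
have Y0 := pmf_inhabited PYp; have [yy _] := card_gt0P Y0.
have Z0 := pmf_inhabited (Wp yy).
have NY0 : 0 < #|Y|%:R :> R by rewrite ltr0n.
(* The distortion excess [g] is split into quarters: 3eC, 2rC, C(9l/r), and C times the bound on a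
   bad sample. *)
pose e := Num.min 1 (g / (12 * C)).
have e0 : 0 < e by rewrite lt_min ltr01 divr_gt0 // mulr_gt0.
have e1' : e <= 1 by rewrite ge_min lexx.
have eC : 12 * (e * C) <= g.
  have : e <= g / (12 * C) by rewrite ge_min lexx orbT.
  by rewrite ler_pdivlMr ?mulr_gt0 //; lra.
have e2 : 0 <= e <= 2 by apply/andP; split; lra.
(* About nk positions of y are stored, at a cost of |Y|^m <= exp(m|Y|) <= exp(ng/2). *)
pose k := g / (2 * #|Y|%:R).
have k0 : 0 < k by rewrite divr_gt0 // mulr_gt0.
(* The ball exponent must stay below half of the sampling exponent me^2/8, which is at least
   nke^2/16; the other bound limits the false-alarm loss to exp(ng). *)
pose e1 := Num.min (k * e ^+ 2 / 32) (g / 2).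
have ke0 : 0 < k * e ^+ 2 / 32 by rewrite divr_gt0 // mulr_gt0 // exprn_gt0.
have e10 : 0 < e1 by rewrite lt_min ke0 divr_gt0.
have e1k : e1 <= k * e ^+ 2 / 32 by rewrite ge_min lexx.
have e1g : 2 * e1 <= g.
  have : e1 <= g / 2 by rewrite ge_min lexx orbT.
  lra.
have [rY rY0 HY] := ball_growth PYp e10.
have [rZ rZ0 HZ] := ball_growth (outlaw_pmf PYp Wp) e10.
have [rU rU0 HU] := ball_card Z0 e10.
pose r := Num.min (Num.min rY rZ) (Num.min rU (g / (8 * C))).
have r0 : 0 < r by rewrite !lt_min rY0 rZ0 rU0 divr_gt0 // mulr_gt0.
have rrY : r <= rY by rewrite !ge_min lexx.
have rrZ : r <= rZ by rewrite !ge_min lexx orbT.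
have rrU : r <= rU by rewrite !ge_min lexx !orbT.
have rC : 8 * (r * C) <= g.
  have : r <= g / (8 * C) by rewrite !ge_min lexx !orbT.
  by rewrite ler_pdivlMr ?mulr_gt0 //; lra.
pose l := Num.min (Num.min (2^-1) (e / 3)) (Num.min (g * r / 9) (g * r / (36 * C))).
have l0 : 0 < l by rewrite !lt_min invr_gt0 ltr0n !divr_gt0 // ?mulr_gt0.
have l2 : 0 < l <= 2^-1 by rewrite l0 !ge_min lexx.
have le3 : l <= e / 3 by rewrite !ge_min lexx !orbT.
have le : l ^+ 2 <= e ^+ 2 / 8.
  apply: (@le_trans _ _ ((e / 3) ^+ 2)); first by rewrite ler_sqr // nnegrE; clear -e0 l0; lra.
  have := sqr_ge0 e; rewrite exprMn; lra.
have lr : 9 * l / r <= g.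
  have : l <= g * r / 9 by rewrite !ge_min lexx !orbT.
  by rewrite ler_pdivrMr //; lra.
have lrC : C * (9 * l / r) <= g / 4.
  have : l <= g * r / (36 * C) by rewrite !ge_min lexx !orbT.
  rewrite ler_pdivlMr ?mulr_gt0 // (_ : C * _ = 9 * l * C / r); last by ring.
  by rewrite ler_pdivrMr //; lra.
have ll0 : 0 < l ^+ 2 by rewrite exprn_gt0.
(* Half of the exponent l^2 is kept to absorb the factor 3 in the hypothesis of [block_core]. *)
exists (l ^+ 2 / 2); first by rewrite divr_gt0.
(* In order, the summands absorb that factor 3, make m positive and at least nk/2, absorb the factor
   2 due to [option], and make bad samples rare. *)
pose N := 4 / l ^+ 2 + 2 / k + 2 / g + 8 * C / g / (k * e ^+ 2 / 32).
have p1 : 0 < 4 / l ^+ 2 by rewrite divr_gt0.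
have p2 : 0 < 2 / k by rewrite divr_gt0.
have p3 : 0 < 2 / g by rewrite divr_gt0.
have p4 : 0 < 8 * C / g / (k * e ^+ 2 / 32) by apply: divr_gt0 => //; rewrite divr_gt0 // mulr_gt0.
exists (Num.truncn N).+1 => n nN S f B h D b D0 succ fa.
have NN : N <= n%:R by rewrite (le_trans (ltW (truncnS_gt N))) // ler_nat.
have n1 : 4 <= n%:R * l ^+ 2 by rewrite -ler_pdivrMr //; clear -p1 p2 p3 p4 NN; rewrite /N in NN; lra.
have n2 : 2 <= n%:R * k by rewrite -ler_pdivrMr //; clear -p1 p2 p3 p4 NN; rewrite /N in NN; lra.
have n3 : 2 <= n%:R * g by rewrite -ler_pdivrMr //; clear -p1 p2 p3 p4 NN; rewrite /N in NN; lra.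
have n4 : 8 * C / g <= n%:R * (k * e ^+ 2 / 32).
  by rewrite -ler_pdivrMr //; clear -p1 p2 p3 p4 NN; rewrite /N in NN; lra.
have n0 : (0 < n)%N by apply: leq_ltn_trans nN.
pose m := Num.truncn (n%:R * k).
have nk0 : 0 <= n%:R * k by clear -n2; lra.
have /andP[m1 m2] := truncn_itv nk0; rewrite -/m in m1 m2.
rewrite -natr1 in m2.
have m0 : (0 < m)%N by rewrite truncn_gt0; clear -n2; lra.
have th3 : 3 * expR (- (n%:R * l ^+ 2)) <= expR (- (n%:R * (l ^+ 2 / 2))).
  rewrite (_ : - (n%:R * l ^+ 2) = - (n%:R * (l ^+ 2 / 2)) - (n%:R * (l ^+ 2 / 2))); last by field.
  rewrite expRD mulrCA ler_piMr ?expR_ge0 // expRN ler_pdivrMr ?expR_gt0 // mul1r.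
  by apply: le_trans (expR_ge1Dx _); clear -n1; lra.
have [F [B1 [H [H1 H2 H3]]]] := @block_core R X Y Z Xh PY W V d C PYp Wp Vp C0 dC
  n m S f B h D b e e1 r l n0 e2 r0 l2 le D0
  (fun a => HY n r a rrY) (fun a => HZ n r a rrZ) (fun a => HU n r a rrU)
  (le_trans th3 succ) fa m0.
exists (option S * {ffun 'I_m -> Y})%type, F, B1, H; split.
- rewrite card_prod card_option card_ffun card_ord natrM natrX.
  have S0 : (0 < #|S|)%N by apply/card_gt0P; exists (f [ffun=> yy]).
  rewrite (_ : n%:R * g = n%:R * g / 2 + n%:R * g / 2); last by field.
  rewrite expRD mulrA; apply: ler_pM => //.
    apply: (@le_trans _ _ (#|S|%:R * 2)).
      by rewrite -natrM ler_nat muln2 -addnn -addn1 leq_add2l.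
    by rewrite ler_wpM2l // (le_trans _ (expR_ge1Dx _)) //; clear -n3; lra.
  apply: (@le_trans _ _ (expR #|Y|%:R ^+ m)).
    rewrite lerXn2r ?nnegrE ?expR_ge0 //.
    by apply: le_trans (expR_ge1Dx _); rewrite lerDr.
  rewrite -expRM_natl ler_expR.
  apply: (@le_trans _ _ (n%:R * k * #|Y|%:R)); first by rewrite ler_wpM2r.
  by apply: eq_imp_le; rewrite /k; field; rewrite gt_eqF.
- by apply: le_trans H1; clear -lr; lra.
- have b0 : 0 <= b.
    apply: le_trans fa; apply: Ex_ge0 => // y; apply: Ex_ge0 => // i.
    exact: outlaw_pmf.
  apply: (le_trans H2); rewrite ler_wpM2r // ler_expR.
  by rewrite [2 * _]mulrC -mulrA ler_wpM2l.
- apply: (le_trans H3).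
  suff : C * (2 * expR (n%:R * e1 - m%:R * e ^+ 2 / 8)) <= g / 4.
    by rewrite mulrDr => H4; clear -H4 lrC eC rC; lra.
  have q1 : expR (n%:R * e1 - m%:R * e ^+ 2 / 8) <= expR (- (8 * C / g)).
    rewrite ler_expR.
    have a1 : n%:R * e1 <= n%:R * (k * e ^+ 2 / 32) by rewrite ler_wpM2l.
    have a2 : n%:R * k / 2 * e ^+ 2 <= m%:R * e ^+ 2 by rewrite ler_wpM2r ?sqr_ge0 //; clear -m2 n2; lra.
    clear -a1 a2 n4; lra.
  have q2 : expR (- (8 * C / g)) <= g / (8 * C).
    rewrite expRN -[leRHS]invrK invf_div lef_pV2 ?posrE ?expR_gt0 ?divr_gt0 ?mulr_gt0 //.
    by apply: le_trans (expR_ge1Dx _); clear; lra.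
  have q3 := le_trans q1 q2.
  apply: (@le_trans _ _ (C * (2 * (g / (8 * C))))); first by rewrite ler_pM2l // ler_pM2l.
  by apply: eq_imp_le; field; rewrite gt_eqF.
Qed.
End BlockRefinement.

(** * The error probability of identification codes *)

Section ErrorProbability.
Variable R : realType.

(** A product of sums expands over sequences, so the intermediate sequence can be summed out letter
    by letter. *)
Lemma Ex_bind (I A B : finType) (p : A -> R) (K : A -> B -> R) (F : {ffun I -> B} -> R) :
  Ex (fun _ : I => p) (fun a => Ex (fun i => K (a i)) F) =
  Ex (fun=> outlaw p K) F.
Proof.
rewrite /Ex; under eq_bigr do rewrite big_distrr /=.
rewrite exchange_big; apply: eq_bigr => b _ /=.
under eq_bigr do rewrite mulrA -big_split /=.
rewrite -big_distrl; congr (_ * _); rewrite /outlaw bigA_distr_bigA.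
by [].
Qed.

(** Redraw coordinate [i], then integrate coordinate [j] alone. *)
Lemma Ex_coord2 (I T : finType) (p : I -> T -> R) i j (phi : T -> T -> R) :
  (forall i, is_pmf (p i)) -> i != j ->
  Ex p (fun t => phi (t i) (t j)) = \sum_a p i a * \sum_b p j b * phi a b.
Proof.
move=> pp ij; rewrite -(Ex_resample i _ pp).
transitivity (Ex p (fun t => \sum_a p i a * phi a (t j))).
  apply: eq_Ex => t; apply: eq_bigr => a _.
  by rewrite !ffunE eqxx eq_sym (negbTE ij).
rewrite Ex_sum; apply: eq_bigr => a _.
by rewrite ExZ (Ex_coord j (phi a)).
Qed.

Variables (X Y Z Xh : finType) (PX : X -> R) (PYX : X -> Y -> R)
  (PZX : X -> Z -> R) (d : X -> Xh -> R).
Hypotheses (HPX : is_pmf PX) (HPYX : is_channel PYX) (HPZX : is_channel PZX).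

Definition law3 (t : X * Y * Z) : R := PX t.1.1 * PYX t.1.1 t.1.2 * PZX t.1.1 t.2.

Definition xpart n (t : {ffun 'I_n -> X * Y * Z}) : {ffun 'I_n -> X} := [ffun i => (t i).1.1].
Definition ypart n (t : {ffun 'I_n -> X * Y * Z}) : {ffun 'I_n -> Y} := [ffun i => (t i).1.2].
Definition zpart n (t : {ffun 'I_n -> X * Y * Z}) : {ffun 'I_n -> Z} := [ffun i => (t i).2].

(** Packing the letters into triples makes this an i.i.d. expectation, to which the block and
    concentration lemmas apply directly. *)
Definition E3 n (F : {ffun 'I_n -> X} -> {ffun 'I_n -> Y} -> {ffun 'I_n -> Z} -> R) : R :=
  Ex (fun=> law3) (fun t => F (xpart t) (ypart t) (zpart t)).

Lemma sum_ffun_triple n (F : {ffun 'I_n -> X} -> {ffun 'I_n -> Y} -> {ffun 'I_n -> Z} -> R) :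
  \sum_x \sum_y \sum_z F x y z =
  \sum_(t : {ffun 'I_n -> X * Y * Z}) F (xpart t) (ypart t) (zpart t).
Proof.
rewrite (sum_ffun_pair (fun x y => \sum_z F x y z)).
rewrite (sum_ffun_pair (fun xy z => F [ffun i => (xy i).1] [ffun i => (xy i).2] z)).
apply: eq_bigr => t _; congr F; apply/ffunP => i; by rewrite !ffunE.
Qed.

Lemma E3_channel n (F : {ffun 'I_n -> X} -> {ffun 'I_n -> Y} -> {ffun 'I_n -> Z} -> R) :
  \sum_x \sum_y iid PX x * dmc PYX x y * \sum_z dmc PZX x z * F x y z = E3 F.
Proof.
transitivity (\sum_x \sum_y \sum_z (iid PX x * dmc PYX x y * dmc PZX x z) * F x y z).
  apply: eq_bigr => x _; apply: eq_bigr => y _; rewrite big_distrr.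
  by apply: eq_bigr => z _ /=; rewrite !mulrA.
rewrite sum_ffun_triple; apply: eq_bigr => t _; congr (_ * _).
rewrite -!big_split; apply: eq_bigr => i _ /=.
by rewrite !ffunE.
Qed.

Definition ylaw (y : Y) : R := outlaw PX PYX y.
Definition zlaw (z : Z) : R := outlaw PX PZX z.

Lemma law3_pmf : is_pmf law3.
Proof.
split=> [t|].
  by rewrite !mulr_ge0 ?HPX.1 ?(HPYX _).1 ?(HPZX _).1.
rewrite -HPX.2 /law3 -(pair_bigA _ (fun xy z => PX xy.1 * PYX xy.1 xy.2 * PZX xy.1 z)) /=.
rewrite -(pair_bigA _ (fun x y => \sum_z PX x * PYX x y * PZX x z)) /=.
apply: eq_bigr => x _.
under eq_bigr do rewrite -big_distrr /= (HPZX x).2 mulr1.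
by rewrite -big_distrr /= (HPYX x).2 mulr1.
Qed.

Let user n := ({ffun 'I_n -> X} * {ffun 'I_n -> Y})%type.
Definition userlaw n (u : user n) : R := iid PX u.1 * dmc PYX u.1 u.2.

Lemma userlaw_pmf n : is_pmf (@userlaw n).
Proof.
split=> [u|]; first by rewrite mulr_ge0 // prodr_ge0 // => i _; rewrite ?HPX.1 ?(HPYX _).1.
rewrite /userlaw -(pair_bigA _ (fun x y => iid PX x * dmc PYX x y)) /=.
rewrite -[RHS](is_pmf_prod (fun _ : 'I_n => HPX)).2; apply: eq_bigr => x _.
rewrite -big_distrr /= -[RHS]mulr1; congr (_ * _).
exact: (is_pmf_prod (fun i => HPYX (x i))).2.
Qed.

Lemma sum_user n (F : user n -> R) :
  \sum_u userlaw u * F u = \sum_x \sum_y iid PX x * dmc PYX x y * F (x, y).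
Proof. by rewrite pair_bigA; apply: eq_bigr => -[x y] _. Qed.

Lemma sum_user_y n (F : {ffun 'I_n -> Y} -> R) :
  \sum_(u : user n) userlaw u * F u.2 = Ex (fun=> ylaw) F.
Proof.
rewrite sum_user -Ex_bind; apply: eq_bigr => x _.
by rewrite big_distrr; apply: eq_bigr => y _; rewrite /= mulrA.
Qed.

Lemma sum_user_z n (F : {ffun 'I_n -> Z} -> R) :
  \sum_(u : user n) userlaw u * (\sum_z dmc PZX u.1 z * F z) = Ex (fun=> zlaw) F.
Proof.
rewrite sum_user -Ex_bind; apply: eq_bigr => x _.
rewrite /= -big_distrl -big_distrr /=; congr (_ * _).
rewrite -[RHS]mulr1; congr (_ * _).
exact: (is_pmf_prod (fun i => HPYX (x i))).2.
Qed.

Lemma error_probE n M L (f : {ffun 'I_n -> Y} -> 'I_L)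
  (g : {ffun 'I_M -> 'I_L} -> {ffun 'I_n -> Z} -> 'I_M)
  (h : 'I_L -> {ffun 'I_n -> Z} -> {ffun 'I_n -> Xh}) (D : R) :
  error_prob PX PYX PZX d f g h D =
  M%:R^-1 * \sum_w Ex (fun _ : 'I_M => @userlaw n) (fun t => \sum_z dmc PZX (t w).1 z *
    (let S := [ffun m => f (t m).2] in
     (g S z != w) || (D < avg_dist d (t w).1 (h (S (g S z)) z)))%:R).
Proof.
rewrite /error_prob big_distrr; apply: eq_bigr => w _ /=.
rewrite sum_ffun_pair /Ex big_distrr; apply: eq_bigr => t _ /=.
rewrite !big_distrr; apply: eq_bigr => z _ /=; rewrite -!mulrA; congr (_ * _).
rewrite ffunE; congr (_ * (_ * _)).
  by apply: eq_bigr => m _; rewrite !ffunE.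
rewrite (_ : [ffun m => f _] = [ffun m => f (t m).2]); first by case: ifP.
by apply/ffunP => m; rewrite !ffunE.
Qed.

Section UnionBound.
Variables (n M L : nat) (f : {ffun 'I_n -> Y} -> 'I_L)
  (acc : 'I_L -> {ffun 'I_n -> Z} -> bool)
  (h : 'I_L -> {ffun 'I_n -> Z} -> {ffun 'I_n -> Xh}) (D : R).

(** The successor [M.+1] provides a default index; [M] is then the number of competitors of the true
    user. *)
Definition pick_user (ss : {ffun 'I_M.+1 -> 'I_L}) z : 'I_M.+1 :=
  odflt ord0 [pick w | acc (ss w) z].

(** If only the true user is accepted, [pick_user] returns it. An error thus needs its rejection,
    the acceptance of another user, or excess distortion with the true message. *)
Lemma union_bound :
  error_prob PX PYX PZX d f pick_user h D <=
  E3 (fun _ y z => (~~ acc (f y) z)%:R) +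
  M%:R * Ex (fun=> ylaw) (fun y => Ex (fun=> zlaw) (fun z => (acc (f y) z)%:R)) +
  E3 (fun x y z => (D < avg_dist d x (h (f y) z))%R%:R).
Proof.
have up i : is_pmf ((fun _ : 'I_M.+1 => @userlaw n) i) by apply: userlaw_pmf.
rewrite error_probE; set K := _ + _ + _.
suff H w : Ex (fun _ : 'I_M.+1 => @userlaw n) (fun t => \sum_z dmc PZX (t w).1 z *
    (let S := [ffun m => f (t m).2] in
     (pick_user S z != w) || (D < avg_dist d (t w).1 (h (S (pick_user S z)) z)))%:R) <= K.
  rewrite mulrC ler_pdivrMr ?ltr0n //; apply: (@le_trans _ _ (\sum_(w < M.+1) K)).
    by apply: ler_sum => w _; apply: H.
  by rewrite sumr_const card_ord -[leLHS]mulr_natr.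
have dz0 (x : {ffun 'I_n -> X}) z : 0 <= dmc PZX x z.
  by apply: prodr_ge0 => i _; apply: (HPZX _).1.
pose T1 (t : {ffun 'I_M.+1 -> user n}) := \sum_z dmc PZX (t w).1 z * (~~ acc (f (t w).2) z)%:R.
pose T3 (t : {ffun 'I_M.+1 -> user n}) := \sum_z dmc PZX (t w).1 z *
  (D < avg_dist d (t w).1 (h (f (t w).2) z))%R%:R.
pose T2 m (t : {ffun 'I_M.+1 -> user n}) := \sum_z dmc PZX (t w).1 z * (acc (f (t m).2) z)%:R.
apply: (@le_trans _ _ (Ex (fun=> @userlaw n) (fun t => T1 t + \sum_(m | m != w) T2 m t + T3 t))).
  apply: le_Ex => // t; rewrite /T1 /T2 /T3 exchange_big -!big_split; apply: ler_sum => z _ /=.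
  rewrite -big_distrr -!mulrDr ler_wpM2l //=.
  set S := finfun _.
  have SE m : S m = f (t m).2 by rewrite ffunE.
  case: (boolP (acc (f (t w).2) z)) => aw /=; last first.
    rewrite -addrA -[leLHS]addr0 lerD ?ler1n ?lern1 ?leq_b1 // ?addr_ge0 //.
    exact: sumr_ge0.
  rewrite add0r; case: (boolP [exists m, (m != w) && acc (f (t m).2) z]) => [/existsP[m /andP[mw am]]|].
    rewrite (bigD1 m) //= am -addrA -[leLHS]addr0 lerD ?lern1 ?leq_b1 // ?addr_ge0 //.
    exact: sumr_ge0.
  rewrite negb_exists => /forallP Hm.
  have pw : pick_user S z = w.
    rewrite /pick_user; case: pickP => [m|/(_ w)]; last by rewrite SE aw.
    rewrite SE /= => am; apply/eqP; have := Hm m; rewrite am andbT negbK //.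
  rewrite pw eqxx /= SE lerDr; exact: sumr_ge0.
rewrite !ExD (Ex_sum _ (fun m => m != w) T2) /K; apply: lerD; first apply: lerD.
- apply: eq_imp_le; etransitivity.
    exact: (Ex_coord w (fun u : user n => \sum_z dmc PZX u.1 z * (~~ acc (f u.2) z)%:R) up).
  by rewrite sum_user E3_channel.
(* For m other than w, the message of m is independent of z, which comes from user w; the pair
   follows the product of the marginals. *)
- apply: (@le_trans _ _ (\sum_(m < M.+1 | m != w)
    Ex (fun=> ylaw) (fun y => Ex (fun=> zlaw) (fun z => (acc (f y) z)%:R)))); last first.
    by rewrite sumr_const cardC1 card_ord -[leLHS]mulr_natl.
  apply: ler_sum => m mw.
  apply: eq_imp_le; etransitivity.
    exact: (Ex_coord2 (fun a b : user n => \sum_z dmc PZX b.1 z * (acc (f a.2) z)%:R) up mw).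
  under eq_bigr => a _ do rewrite (sum_user_z (fun z => (acc (f a.2) z)%:R)).
  by rewrite (sum_user_y (fun y => Ex (fun=> zlaw) (fun z => (acc (f y) z)%:R))).
- apply: eq_imp_le; etransitivity.
    exact: (Ex_coord w (fun u : user n => \sum_z dmc PZX u.1 z *
      (D < avg_dist d u.1 (h (f u.2) z))%R%:R) up).
  by rewrite sum_user E3_channel.
Qed.
End UnionBound.
End ErrorProbability.

(** * Super-blocks and achievability *)

Section SuperBlock.
Variable R : realType.

Section Blocks.
Variables (N q n : nat) (pos : 'I_q * 'I_n -> 'I_N).
Hypothesis pos_inj : injective pos.

Definition blk (T : finType) (t : {ffun 'I_N -> T}) (j : 'I_q) : {ffun 'I_n -> T} :=
  [ffun k => t (pos (j, k))].

(** Injectivity of [pos] makes the blocks disjoint, hence independent super-letters; the remaining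
    letters are marginalized by [Ex_inj]. *)
Lemma Ex_blocks (T : finType) (p : T -> R) (Phi : {ffun 'I_q -> {ffun 'I_n -> T}} -> R) :
  is_pmf p ->
  Ex (fun _ : 'I_N => p) (fun t => Phi [ffun j => blk t j]) =
  Ex (fun (_ : 'I_q) (u : {ffun 'I_n -> T}) => \prod_k p (u k)) Phi.
Proof.
move=> pp; pose G (s : {ffun 'I_q * 'I_n -> T}) := Phi [ffun j => [ffun k => s (j, k)]].
transitivity (Ex (fun _ : 'I_N => p) (fun t => G [ffun jk => t (pos jk)])).
  apply: eq_Ex => t; congr Phi; apply/ffunP => j; rewrite !ffunE.
  by apply/ffunP => k; rewrite !ffunE.
rewrite Ex_inj // /Ex.
rewrite (reindex (fun v : {ffun 'I_q -> {ffun 'I_n -> T}} => [ffun jk => v jk.1 jk.2])) /=.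
  apply: eq_bigr => v _; congr (_ * _).
    by rewrite pair_bigA; apply: eq_bigr => jk _; rewrite ffunE.
  congr Phi; apply/ffunP => j; rewrite !ffunE; apply/ffunP => k; by rewrite !ffunE.
exists (fun s : {ffun 'I_q * 'I_n -> T} => [ffun j => [ffun k => s (j, k)]]).
  move=> v _; apply/ffunP => j; rewrite !ffunE; apply/ffunP => k; by rewrite !ffunE.
by move=> s _; apply/ffunP => -[j k]; rewrite !ffunE.
Qed.

Lemma sum_blocks_le (phi : 'I_N -> R) (C : R) : (forall i, 0 <= phi i <= C) ->
  \sum_i phi i <= \sum_j \sum_k phi (pos (j, k)) + (N - q * n)%:R * C.
Proof.
move=> phiC; rewrite (bigID (fun i => i \in imset pos (mem predT))) /=; apply: lerD.
  rewrite big_imset /=; last by move=> i j _ _; apply: pos_inj.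
  rewrite pair_bigA /=; apply: eq_imp_le; apply: eq_big => [j|[j k] _ //].
  by rewrite inE.
apply: (@le_trans _ _ (\sum_(i | i \notin imset pos (mem predT)) C)).
  by apply: ler_sum => i _; have /andP[] := phiC i.
rewrite sumr_const -[leLHS]mulr_natl; apply: eq_imp_le; congr (_%:R * _).
have <- : #|imset pos (mem predT)| = (q * n)%N.
  by rewrite card_imset // cardT -cardE card_prod !card_ord.
have := cardC (mem (imset pos (mem predT))); rewrite card_ord => NE.
by rewrite -[X in (X - _)%N]NE addKn.
Qed.
End Blocks.

Section Code.
Variables (X Y Z Xh : finType) (PX : X -> R) (PYX : X -> Y -> R)
  (PZX : X -> Z -> R) (d : X -> Xh -> R) (C : R).
Hypotheses (HPX : is_pmf PX) (HPYX : is_channel PYX) (HPZX : is_channel PZX).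
Hypotheses (C0 : 0 < C) (dC : forall x xh, 0 <= d x xh <= C).
Variables (n : nat) (S : finType) (F : {ffun 'I_n -> Y} -> S)
  (B : S -> {ffun 'I_n -> Z} -> bool) (H : S -> {ffun 'I_n -> Z} -> {ffun 'I_n -> Xh}).
Variables (g tau D0 D : R) (xh0 : Xh).
Hypotheses (n0 : (0 < n)%N) (g02 : 0 <= g <= 2) (tau0 : 0 <= tau) (D00 : 0 <= D).
Hypothesis accepts : 1 - g <= E3 PX PYX PZX (fun (_ : {ffun 'I_n -> X}) y z => (B (F y) z)%:R).
Hypothesis false_alarm :
  Ex (fun=> ylaw PX PYX) (fun y : {ffun 'I_n -> Y} =>
    Ex (fun=> zlaw PX PZX) (fun z => (B (F y) z)%:R)) <= expR (- tau).
Hypothesis distortion :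
  E3 PX PYX PZX (fun x y z => avg_dist d x (H (F y) z)) <= D0.

Variables (N q : nat) (pos : 'I_q * 'I_n -> 'I_N).
Hypothesis pos_inj : injective pos.
Hypotheses (qnN : (q * n <= N)%N) (Nqn : (N - q * n <= n)%N).

Definition sb_enc (y : {ffun 'I_N -> Y}) : 'I_#|{ffun 'I_q -> S}| :=
  enum_rank [ffun j => F (blk pos y j)].
(** A block is accepted with probability at least 1 - g, so this threshold leaves a gap g for
    concentration. *)
Definition sb_acc (s : 'I_#|{ffun 'I_q -> S}|) (z : {ffun 'I_N -> Z}) : bool :=
  ((1 - 2 * g) * q%:R <= \sum_j (B (enum_val s j) (blk pos z j))%:R)%R.
(** Positions outside all blocks receive [xh0]; [sum_blocks_le] charges each of them at most [C]. *)
Definition sb_rep (s : 'I_#|{ffun 'I_q -> S}|) (z : {ffun 'I_N -> Z}) : {ffun 'I_N -> Xh} :=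
  [ffun i => if [pick jk | pos jk == i] is Some jk
             then H (enum_val s jk.1) (blk pos z jk.1) jk.2 else xh0].

Let lw := fun (_ : 'I_q) (u : {ffun 'I_n -> X * Y * Z}) => \prod_k law3 PX PYX PZX (u k).
Let lwp j : is_pmf (lw j).
Proof. exact: (is_pmf_prod (fun _ : 'I_n => law3_pmf HPX HPYX HPZX)). Qed.

Lemma E3_blocks (Phi : ('I_q -> {ffun 'I_n -> X}) -> ('I_q -> {ffun 'I_n -> Y}) ->
    ('I_q -> {ffun 'I_n -> Z}) -> R) :
  E3 PX PYX PZX (fun x y z => Phi (blk pos x) (blk pos y) (blk pos z)) =
  Ex lw (fun v => Phi (fun j => xpart (v j)) (fun j => ypart (v j)) (fun j => zpart (v j))).
Proof.
etransitivity; last first.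
  exact: (Ex_blocks pos_inj (fun v : {ffun 'I_q -> {ffun 'I_n -> X * Y * Z}} => Phi (fun j => xpart (v j)) (fun j => ypart (v j)) (fun j => zpart (v j))) (law3_pmf HPX HPYX HPZX)).
apply: eq_Ex => t; congr Phi; apply/funext => j; rewrite ffunE;
  by apply/ffunP => k; rewrite !ffunE.
Qed.

Lemma sb_accepts : E3 PX PYX PZX (fun (_ : {ffun 'I_N -> X}) y z => (~~ sb_acc (sb_enc y) z)%:R) <=
  expR (- (q%:R * g ^+ 2 / 8)).
Proof.
pose a (u : {ffun 'I_n -> X * Y * Z}) : R := (B (F (ypart u)) (zpart u))%:R.
have -> : E3 PX PYX PZX (fun (_ : {ffun 'I_N -> X}) y z => (~~ sb_acc (sb_enc y) z)%:R) =
    Ex lw (fun v => (\sum_j a (v j) < (1 - 2 * g) * q%:R)%R%:R).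
  rewrite -(E3_blocks (fun _ y z => (\sum_j (B (F (y j)) (z j))%:R < (1 - 2 * g) * q%:R)%R%:R)).
  apply: eq_Ex => t; rewrite /sb_acc /sb_enc enum_rankK -ltNge.
  by under eq_bigr do rewrite ffunE.
have la : lip (fun v : {ffun 'I_q -> {ffun 'I_n -> X * Y * Z}} => \sum_j a (v j)).
  apply: (lip_sum (phi := fun _ => a)) => _ u u'; rewrite /a.
  by case: (B _ _); case: (B _ _); rewrite ?subrr ?subr0 ?sub0r //; lra.
apply: le_trans (tail_lower lwp la g02); apply: le_Ex => // v.
rewrite ler_nat; case: ltP => //= Hv; rewrite (_ : (_ <= _)%R = true) //.
rewrite (le_trans (ltW Hv)) // (Ex_sum_coord (fun _ => a)) //.
have E j : 1 - g <= \sum_u lw j u * a u by exact: accepts.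
have : q%:R * (1 - g) <= \sum_j \sum_u lw j u * a u.
  apply: (@le_trans _ _ (\sum_(j < q) (1 - g))); last by apply: ler_sum.
  by rewrite sumr_const card_ord -[leRHS]mulr_natl.
lra.
Qed.

(** Chernoff bound with parameter [tau] on the number of accepting blocks: each block contributes at
    most 1 + exp(tau)exp(-tau) = 2 <= e, whence the term q in the exponent. *)
Lemma sb_false_alarm :
  Ex (fun=> ylaw PX PYX) (fun y : {ffun 'I_N -> Y} =>
    Ex (fun=> zlaw PX PZX) (fun z => (sb_acc (sb_enc y) z)%:R)) <=
  expR (q%:R - tau * ((1 - 2 * g) * q%:R)).
Proof.
have ylp : is_pmf (ylaw PX PYX) by apply: outlaw_pmf.
have zlp : is_pmf (zlaw PX PZX) by apply: outlaw_pmf.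
pose ly := fun (_ : 'I_q) (u : {ffun 'I_n -> Y}) => \prod_k ylaw PX PYX (u k).
pose lz := fun (_ : 'I_q) (u : {ffun 'I_n -> Z}) => \prod_k zlaw PX PZX (u k).
have lyp j : is_pmf (ly j) by exact: (is_pmf_prod (fun _ : 'I_n => ylp)).
have lzp j : is_pmf (lz j) by exact: (is_pmf_prod (fun _ : 'I_n => zlp)).
pose thr := (1 - 2 * g) * q%:R.
have -> : Ex (fun=> ylaw PX PYX) (fun y : {ffun 'I_N -> Y} =>
    Ex (fun=> zlaw PX PZX) (fun z => (sb_acc (sb_enc y) z)%:R)) =
  Ex ly (fun ys => Ex lz (fun zs => (thr <= \sum_j (B (F (ys j)) (zs j))%:R)%R%:R)).
  rewrite -(Ex_blocks pos_inj _ ylp); apply: eq_Ex => y.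
  rewrite -(Ex_blocks pos_inj _ zlp); apply: eq_Ex => z.
  rewrite /sb_acc /sb_enc enum_rankK; congr (_ <= _)%R%:R.
  by apply: eq_bigr => j _; rewrite !ffunE.
apply: (@le_trans _ _ (Ex ly (fun ys => Ex lz (fun zs => expR (- (tau * thr)) *
   \prod_j (1 + expR tau * (B (F (ys j)) (zs j))%:R))))).
  apply: le_Ex => // ys; apply: le_Ex => // zs.
  have p0 j : 0 <= expR (tau * (B (F (ys j)) (zs j))%:R) <= 1 + expR tau * (B (F (ys j)) (zs j))%:R.
    rewrite expR_ge0 /=; case: (B _ _); rewrite ?mulr1 ?mulr0 ?expR0 ?addr0 //.
    by rewrite lerDr.
  apply: (@le_trans _ _ (expR (- (tau * thr)) * \prod_j expR (tau * (B (F (ys j)) (zs j))%:R))).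
    rewrite -expR_sum -big_distrr -expRD /=; case: (leP thr) => /= [Ht|_]; last by rewrite expR_ge0.
    by apply: ge1_expR; have := ler_wpM2l tau0 Ht; lra.
  rewrite ler_wpM2l ?expR_ge0 //; apply: ler_prod => j _; exact: p0.
have -> : Ex ly (fun ys => Ex lz (fun zs => expR (- (tau * thr)) *
   \prod_j (1 + expR tau * (B (F (ys j)) (zs j))%:R))) =
  expR (- (tau * thr)) * \prod_(j < q) \sum_u ly j u * \sum_v lz j v * (1 + expR tau * (B (F u) v)%:R).
  under eq_Ex => ys do rewrite ExZ (Ex_prod lz (fun j v => 1 + expR tau * (B (F (ys j)) v)%:R)).
  by rewrite ExZ (Ex_prod ly (fun j u => \sum_v lz j v * (1 + expR tau * (B (F u) v)%:R))).
rewrite addrC expRD ler_wpM2l ?expR_ge0 //.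
rewrite -[q%:R]mulr1 expRM_natl -[in leRHS](card_ord q) -prodr_const.
apply: ler_prod => j _; apply/andP; split.
  apply: sumr_ge0 => u _; rewrite mulr_ge0 ?(lyp j).1 //; apply: sumr_ge0 => v _.
  by rewrite mulr_ge0 ?(lzp j).1 // addr_ge0 // mulr_ge0 // expR_ge0.
apply: (@le_trans _ _ 2); last by apply: le_trans (expR_ge1Dx _); lra.
have -> : \sum_u ly j u * (\sum_v lz j v * (1 + expR tau * (B (F u) v)%:R)) =
   1 + expR tau * Ex (fun=> ylaw PX PYX) (fun y : {ffun 'I_n -> Y} =>
    Ex (fun=> zlaw PX PZX) (fun z => (B (F y) z)%:R)).
  have := ExZ (fun=> ylaw PX PYX) (expR tau) (fun y : {ffun 'I_n -> Y} =>
    Ex (fun=> zlaw PX PZX) (fun z => (B (F y) z)%:R)).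
  move=> <-; rewrite -[X in X + _](@Ex_const R 'I_n _ (fun=> ylaw PX PYX) 1) // -ExD.
  apply: eq_bigr => u _; congr (_ * _).
  rewrite -ExZ -[X in X + _](@Ex_const R 'I_n _ (fun=> zlaw PX PZX) 1) // -ExD.
  by [].
have : expR tau * Ex (fun=> ylaw PX PYX) (fun y : {ffun 'I_n -> Y} =>
    Ex (fun=> zlaw PX PZX) (fun z => (B (F y) z)%:R)) <= expR tau * expR (- tau).
  by rewrite ler_wpM2l ?expR_ge0.
by rewrite -expRD subrr expR0; lra.
Qed.

(** Block distortions are independent, lie in [0, C] and have mean at most [D0]. The at most n
    leftover letters cost nC, which is the summand C after division by n. *)
Lemma sb_distortion e : 0 <= e <= 2 -> q%:R * (D0 + e * C) + C <= q%:R * D ->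
  E3 PX PYX PZX (fun x y z => (D < avg_dist d x (sb_rep (sb_enc y) z))%R%:R) <=
  expR (- (q%:R * e ^+ 2 / 8)).
Proof.
move=> e2 qD; pose a (u : {ffun 'I_n -> X * Y * Z}) : R :=
  avg_dist d (xpart u) (H (F (ypart u)) (zpart u)) / C.
have nR0 : 0 < n%:R :> R by rewrite ltr0n.
have aC (x : {ffun 'I_n -> X}) xh : 0 <= avg_dist d x xh <= C.
  rewrite /avg_dist divr_ge0 //=; last by apply: sumr_ge0 => i _; have /andP[] := dC (x i) (xh i).
  rewrite ler_pdivrMr // mulr_natr -[in leRHS](card_ord n) -sumr_const.
  by apply: ler_sum => i _; have /andP[] := dC (x i) (xh i).
have la : lip (fun v : {ffun 'I_q -> {ffun 'I_n -> X * Y * Z}} => \sum_j a (v j)).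
  apply: (lip_sum (phi := fun _ => a)) => _ u u'; apply: scaled_le1 => //.
    by have /andP[] := aC (xpart u) (H (F (ypart u)) (zpart u)).
  by have /andP[] := aC (xpart u') (H (F (ypart u')) (zpart u')).
have Ea j : \sum_u lw j u * a u <= D0 / C.
  rewrite /a; under eq_bigr do rewrite mulrA.
  by rewrite -big_distrl /= ler_pM2r ?invr_gt0 //; exact: distortion.
have Esum : Ex lw (fun v => \sum_j a (v j)) <= q%:R * (D0 / C).
  rewrite (Ex_sum_coord (fun _ => a)) //.
  apply: (@le_trans _ _ (\sum_(j < q) (D0 / C))); first by apply: ler_sum.
  by rewrite sumr_const card_ord -[leLHS]mulr_natl.
apply: le_trans (tail_upper lwp la e2).
rewrite -(E3_blocks (fun x y z => (Ex lw (fun v => \sum_j a (v j)) + q%:R * e <=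
  \sum_j avg_dist d (x j) (H (F (y j)) (z j)) / C)%R%:R)).
apply: le_Ex => [i|t]; first exact: law3_pmf.
rewrite ler_nat; set x := xpart t; set y := ypart t; set z := zpart t.
case: ltP => //= Hd; rewrite (_ : (_ <= _)%R = true) //.
rewrite -big_distrl /= ler_pdivlMr //.
(* At length zero the average distortion is 0 and cannot exceed the nonnegative [D]. *)
have N0 : (0 < N)%N.
  rewrite lt0n; apply/eqP => N0; move: Hd; rewrite /avg_dist.
  rewrite big1 ?mul0r ?ltNge ?D00 // => i _.
  by have := leq_ltn_trans (leq0n i) (ltn_ord i); rewrite [X in (_ < X)%N]N0.
have NR0 : 0 < N%:R :> R by rewrite ltr0n.
have S1 : N%:R * D < \sum_i d (x i) (sb_rep (sb_enc y) z i).
  by move: Hd; rewrite /avg_dist ltr_pdivlMr // mulrC.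
have S2 := sum_blocks_le pos_inj (fun i => dC (x i) (sb_rep (sb_enc y) z i)).
have S3 : \sum_j \sum_k d (x (pos (j, k))) (sb_rep (sb_enc y) z (pos (j, k))) =
   n%:R * \sum_j avg_dist d (blk pos x j) (H (F (blk pos y j)) (blk pos z j)).
  rewrite big_distrr; apply: eq_bigr => j _ /=.
  rewrite /avg_dist mulrC divfK ?gt_eqF //; apply: eq_bigr => k _.
  rewrite !ffunE; case: pickP => [jk /eqP/pos_inj ->|/(_ (j, k))]; last by rewrite eqxx.
  by rewrite /sb_enc enum_rankK ffunE.
rewrite S3 in S2.
have S4 : (N - q * n)%:R * C <= n%:R * C by rewrite ler_wpM2r ?ler_nat // ltW.
have S5 : q%:R * n%:R * D <= N%:R * D by rewrite -natrM ler_wpM2r // ler_nat.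
set SS := \sum_j avg_dist _ _ _ in S2 *.
have S6 : n%:R * (q%:R * D) <= n%:R * (SS + C) by lra.
rewrite ler_pM2l // in S6.
have S7 : Ex lw (fun v => \sum_j a (v j)) * C <= q%:R * D0.
  by rewrite -ler_pdivlMr // -mulrA.
rewrite mulrDl; lra.
Qed.
End Code.
End SuperBlock.

(** * Achievability from repeated blocks *)

Section Achievability.
Variable R : realType.

Lemma limn_esup_le (u : nat -> \bar R) (c : \bar R) N :
  (forall n, (N <= n)%N -> (u n <= c)%E) -> (limn_esup u <= c)%E.
Proof.
move=> H; rewrite /limn_esup limf_esupE.
apply: (@le_trans _ _ (ereal_sup [set u n | n in [set n | (N <= n)%N]]%classic)).
  by apply: ereal_inf_lbound; exists [set n | (N <= n)%N]%classic => //; exact: nbhs_infty_ge.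
by apply: ub_ereal_sup => _ [n /= Nn <-]; apply: H.
Qed.

Lemma limn_esup_lt (u : nat -> \bar R) (c : \bar R) :
  (limn_esup u < c)%E -> exists N, forall n, (N <= n)%N -> (u n < c)%E.
Proof.
rewrite /limn_esup limf_esupE => /ereal_inf_lt[_ [V [N _ NV] <-] Vc].
exists N => n Nn; apply: le_lt_trans Vc; apply: ereal_sup_ubound.
by exists n => //; apply: NV.
Qed.

Lemma limn_einf_ge (u : nat -> \bar R) (c : \bar R) N :
  (forall n, (N <= n)%N -> (c <= u n)%E) -> (c <= limn_einf u)%E.
Proof.
move=> H; rewrite /limn_einf leeNr; apply: (@limn_esup_le _ _ N) => n Nn.
by rewrite leeN2 H.
Qed.

Lemma limn_einf_gt (u : nat -> \bar R) (c : \bar R) :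
  (c < limn_einf u)%E -> exists N, forall n, (N <= n)%N -> (c < u n)%E.
Proof.
rewrite /limn_einf lteNr => /limn_esup_lt[N H]; exists N => n /H.
by rewrite lteN2.
Qed.

Lemma expR_decay (K k e : R) : 0 <= K -> 0 < k -> 0 < e ->
  exists q0, forall q, (q0 <= q)%N -> K * expR (- (q%:R * k)) <= e.
Proof.
move=> K0 k0 e0; exists (Num.truncn (K / e / k)).+1 => q qq.
rewrite expRN ler_pdivrMr ?expR_gt0 //.
apply: (@le_trans _ _ (e * (1 + q%:R * k))); last by rewrite ler_pM2l // expR_ge1Dx.
have : K / e / k <= q%:R.
  by rewrite (le_trans (ltW (truncnS_gt _))) // ler_nat.
rewrite !ler_pdivrMr //; nra.
Qed.

Variables (X Y Z Xh : finType) (PX : X -> R) (PYX : X -> Y -> R)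
  (PZX : X -> Z -> R) (d : X -> Xh -> R) (C : R).
Hypotheses (HPX : is_pmf PX) (HPYX : is_channel PYX) (HPZX : is_channel PZX).
Hypotheses (C0 : 0 < C) (dC : forall x xh, 0 <= d x xh <= C).

Lemma block_pos_subproof N n (jk : 'I_(N %/ n) * 'I_n) : (jk.1 * n + jk.2 < N)%N.
Proof.
case: jk => j k /=; apply: leq_trans (leq_trunc_div N n).
apply: (@leq_trans (j.+1 * n)); first by rewrite mulSn addnC ltn_add2r.
by rewrite leq_mul2r ltn_ord orbT.
Qed.
Definition block_pos N n (jk : 'I_(N %/ n) * 'I_n) : 'I_N := Ordinal (block_pos_subproof jk).

Lemma block_pos_inj N n : injective (@block_pos N n).
Proof.
move=> [j k] [j' k'] /(congr1 val) /= E.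
have n0 : (0 < n)%N by apply: leq_ltn_trans (ltn_ord k).
have kk : k = k'.
  by apply: val_inj; have := congr1 (modn^~ n) E; rewrite !modnMDl !modn_small.
have jj : j = j'.
  apply: val_inj; have := congr1 (divn^~ n) E.
  by rewrite !divnMDl // (divn_small (ltn_ord k)) (divn_small (ltn_ord k')) !addn0.
by rewrite kk jj.
Qed.

(** The block length n stays fixed while the number N/n of blocks grows. The 1 in the rate condition
    pays for the factor e per block in [sb_false_alarm]. *)
Lemma superblock_achievable (n : nat) (S : finType) (F : {ffun 'I_n -> Y} -> S)
  (B : S -> {ffun 'I_n -> Z} -> bool) (H : S -> {ffun 'I_n -> Z} -> {ffun 'I_n -> Xh})
  (g tau D0 D Rm Rc eps : R) (xh0 : Xh) :
  (0 < n)%N -> 0 < g <= 1 -> 0 <= tau -> 0 <= D0 -> D0 + g <= D -> 0 < eps ->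
  n%:R * Rm + 1 < (1 - 2 * g) * tau -> ln #|S|%:R <= n%:R * Rc ->
  1 - g <= E3 PX PYX PZX (fun (_ : {ffun 'I_n -> X}) y z => (B (F y) z)%:R) ->
  Ex (fun=> ylaw PX PYX) (fun y : {ffun 'I_n -> Y} =>
    Ex (fun=> zlaw PX PZX) (fun z => (B (F y) z)%:R)) <= expR (- tau) ->
  E3 PX PYX PZX (fun x y z => avg_dist d x (H (F y) z)) <= D0 ->
  eps_achievable PX PYX PZX d eps (Rm, Rc, D).
Proof.
move=> n0 /andP[g0 g1] tau0 D00 DD e0 rate SRc acc fa dist.
have nR0 : 0 < n%:R :> R by rewrite ltr0n.
have Y0 : (0 < #|Y|)%N.
  have [x _] := card_gt0P (pmf_inhabited HPX).
  exact: pmf_inhabited (HPYX x).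
have [y0 _] := card_gt0P Y0.
have S0 : (0 < #|S|)%N by apply/card_gt0P; exists (F [ffun=> y0]).
have SR0 : 1 <= #|S|%:R :> R by rewrite ler1n.
(* [K N] counts the competitors and is at most exp(N Rm), while with the true user the number
   exceeds exp(N Rm). *)
pose K N := Num.truncn (expR (N%:R * Rm)).
exists (fun N => (K N).+1), (fun N => #|{ffun 'I_(N %/ n) -> S}|).
exists (fun N => sb_enc F (@block_pos N n)).
exists (fun N => @pick_user Z N (K N) _ (sb_acc B g (@block_pos N n))).
exists (fun N => sb_rep H xh0 (@block_pos N n)).
split => //=.
- apply: (@limn_einf_ge _ _ 1) => N N0; rewrite lee_fin ler_pdivlMr ?ltr0n //.
  rewrite -ler_expR lnK ?posrE ?ltr0n // mulrC.
  by rewrite ltW // truncnS_gt.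
- apply: (@limn_esup_le _ _ 1) => N N0; rewrite lee_fin ler_pdivrMr ?ltr0n //.
  have Rc0 : 0 <= Rc by rewrite -(pmulr_rge0 _ nR0) (le_trans _ SRc) // ln_ge0.
  rewrite card_ffun card_ord natrX lnXn ?ltr0n // -[leLHS]mulr_natl mulrC.
  apply: (@le_trans _ _ (n%:R * Rc * (N %/ n)%:R)); first by rewrite ler_wpM2r.
  by rewrite mulrAC mulrC ler_wpM2l // -natrM ler_nat mulnC leq_trunc_div.
- pose e := Num.min 2 (g / (2 * C)).
  have ee0 : 0 < e by rewrite lt_min ltr0n divr_gt0 // mulr_gt0.
  have e2 : 0 <= e <= 2 by rewrite ltW //= ge_min lexx.
  have eC : 2 * (e * C) <= g.
    have : e <= g / (2 * C) by rewrite ge_min lexx orbT.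
    by rewrite ler_pdivlMr ?mulr_gt0 //; lra.
  have D_ge0 : 0 <= D by lra.
  have e30 : 0 < eps / 3 by rewrite divr_gt0.
  (* The exponent per block that survives the union bound over the competitors. *)
  pose k2 := (1 - 2 * g) * tau - 1 - n%:R * Rm.
  have k20 : 0 < k2 by rewrite /k2; lra.
  have [q1 Hq1] := @expR_decay 1 (g ^+ 2 / 8) (eps / 3) ler01
    (divr_gt0 (exprn_gt0 2 g0) (ltr0n _ 8)) e30.
  (* The constant exp(n|Rm|) covers the fewer than n letters outside the blocks. *)
  have [q2 Hq2] := expR_decay (expR_ge0 (n%:R * `|Rm|)) k20 e30.
  have [q3 Hq3] := @expR_decay 1 (e ^+ 2 / 8) (eps / 3) ler01
    (divr_gt0 (exprn_gt0 2 ee0) (ltr0n _ 8)) e30.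
  (* From [q4] blocks on, the leftover cost C is at most qg/2, half of the distortion slack. *)
  pose q4 := (Num.truncn (2 * C / g)).+1.
  apply: (@limn_esup_le _ _ ((q1 + q2 + q3 + q4) * n)%N) => N HN; rewrite lee_fin.
  pose q := (N %/ n)%N.
  have qq : (q1 + q2 + q3 + q4 <= q)%N by rewrite leq_divRL.
  have qnN : (q * n <= N)%N by apply: leq_trunc_div.
  have Nqn : (N - q * n <= n)%N.
    by rewrite [X in (X - _)%N](divn_eq N n) addKn ltnW // ltn_pmod.
  have g02 : 0 <= g <= 2 by apply/andP; split; lra.
  have q4q : C <= q%:R * g / 2.
    have : 2 * C / g <= q%:R.
      rewrite (le_trans (ltW (truncnS_gt _))) // ler_nat (leq_trans _ qq) //.
      exact: leq_addl.
    by rewrite ler_pdivrMr //; lra.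
  apply: (le_trans (union_bound d HPX HPYX HPZX _ _ _ _ _)).
  have A1 := sb_accepts HPX HPYX HPZX g02 acc (@block_pos_inj N n).
  have A2 := sb_false_alarm HPX HPYX HPZX g tau0 fa (@block_pos_inj N n).
  have A3 := sb_distortion HPX HPYX HPZX C0 dC xh0 n0 D_ge0 dist
    (@block_pos_inj N n) qnN Nqn e2.
  have qe : q%:R * (D0 + e * C) + C <= q%:R * D.
    have a1 : q%:R * (2 * (e * C)) <= q%:R * g by rewrite ler_wpM2l.
    have a2 : q%:R * (D0 + g) <= q%:R * D by rewrite ler_wpM2l.
    lra.
  have {}A3 := A3 qe.
  rewrite (_ : eps = eps / 3 + eps / 3 + eps / 3); last by field.
  apply: lerD; first apply: lerD.
  + apply: (le_trans A1); have := Hq1 q _; rewrite mul1r mulrA; apply.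
    by apply: leq_trans qq; rewrite -!addnA leq_addr.
  + apply: (@le_trans _ _ (expR (N%:R * Rm) * expR (q%:R - tau * ((1 - 2 * g) * q%:R)))).
      apply: ler_pM => //; last by rewrite truncn_le expR_ge0.
      apply: Ex_ge0 => [i|y]; first exact: outlaw_pmf.
      by apply: Ex_ge0 => // i; apply: outlaw_pmf.
    have q2q : (q2 <= q)%N.
      by apply: leq_trans qq; rewrite -!addnA addnCA leq_addr.
    apply: le_trans (Hq2 q q2q); rewrite -!expRD ler_expR /k2.
    have b1 : N%:R * Rm <= q%:R * n%:R * Rm + n%:R * `|Rm|.
      rewrite [X in X%:R * _](divn_eq N n) natrD natrM mulrDl lerD2l.
      apply: (@le_trans _ _ ((N %% n)%:R * `|Rm|)); first by rewrite ler_wpM2l // ler_norm.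
      by rewrite ler_wpM2r // ler_nat ltnW // ltn_pmod.
    lra.
  + apply: (le_trans A3); have := Hq3 q _; rewrite mul1r mulrA; apply.
    by apply: leq_trans qq; rewrite addnAC leq_addl.
Qed.
End Achievability.

(** * Reduction of a code to a test, and conclusion *)

Section Converse.
Variable R : realType.
Variables (X Y Z Xh : finType) (PX : X -> R) (PYX : X -> Y -> R)
  (PZX : X -> Z -> R) (d : X -> Xh -> R).
Hypotheses (HPX : is_pmf PX) (HPYX : is_channel PYX) (HPZX : is_channel PZX).

Let user n := ({ffun 'I_n -> X} * {ffun 'I_n -> Y})%type.

(* [B s z] says that a user w with stored message s is identified from z, for
   some fixed w and fixed messages of the other users. Averaged over these
   choices, the false-alarm probability is 1/M because the decoder answers a
   single index. *)
Lemma one_user_test n M L (f : {ffun 'I_n -> Y} -> 'I_L)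
  (g : {ffun 'I_M -> 'I_L} -> {ffun 'I_n -> Z} -> 'I_M)
  (h : 'I_L -> {ffun 'I_n -> Z} -> {ffun 'I_n -> Xh}) (D p : R) :
  (0 < M)%N -> 0 < p -> p <= 1 - error_prob PX PYX PZX d f g h D ->
  exists B : 'I_L -> {ffun 'I_n -> Z} -> bool,
    p / 2 <= E3 PX PYX PZX (fun x y z =>
       (B (f y) z)%:R * (avg_dist d x (h (f y) z) <= D)%R%:R) /\
    Ex (fun=> ylaw PX PYX) (fun y => Ex (fun=> zlaw PX PZX) (fun z => (B (f y) z)%:R))
      <= 2 / (M%:R * p).
Proof.
move=> M0 p0 pe.
have MR0 : 0 < M%:R :> R by rewrite ltr0n.
have up i : is_pmf ((fun _ : 'I_M => @userlaw R X Y PX PYX n) i) by apply: userlaw_pmf.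
have zp i : is_pmf ((fun _ : 'I_n => zlaw PX PZX) i) by apply: outlaw_pmf.
have yp i : is_pmf ((fun _ : 'I_n => ylaw PX PYX) i) by apply: outlaw_pmf.
have l3 i : is_pmf ((fun _ : 'I_n => law3 PX PYX PZX) i) by apply: law3_pmf.
pose St (t : {ffun 'I_M -> user n}) : {ffun 'I_M -> 'I_L} := [ffun m => f (t m).2].
pose B w (t : {ffun 'I_M -> user n}) (s : 'I_L) (z : {ffun 'I_n -> Z}) :=
  g [ffun m => if m == w then s else f (t m).2] z == w.
pose joint w t := E3 PX PYX PZX (fun x y z =>
  (B w t (f y) z)%:R * (avg_dist d x (h (f y) z) <= D)%R%:R).
pose indep w t := Ex (fun=> ylaw PX PYX) (fun y =>
  Ex (fun=> zlaw PX PZX) (fun z => (B w t (f y) z)%:R)).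
pose upd w (t : {ffun 'I_M -> user n}) a : {ffun 'I_M -> user n} :=
  [ffun i => if i == w then a else t i].
have St_upd w t a : St (upd w t a) = [ffun m => if m == w then f a.2 else f (t m).2].
  by apply/ffunP => m; rewrite !ffunE; case: eqP.
(* Redrawing user w couples its message with z as in the code, so the sum over w counts correct
   decodings. *)
have joint_sum : \sum_w Ex (fun=> @userlaw R X Y PX PYX n) (joint w) =
    M%:R * (1 - error_prob PX PYX PZX d f g h D).
  rewrite error_probE mulrBr mulr1 mulrA divff ?gt_eqF // mul1r.
  rewrite -[M in M%:R](card_ord M) -[#|_|%:R]sumr_const -sumrB; apply: eq_bigr => w _.
  rewrite -[X in X - _](Ex_const _ up) -ExB.
  rewrite -[RHS](Ex_resample w _ up); apply: eq_Ex => t.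
  have -> : joint w t = \sum_(a : user n) userlaw PX PYX a * (\sum_z dmc PZX a.1 z *
      ((B w t (f a.2) z)%:R * (avg_dist d a.1 (h (f a.2) z) <= D)%R%:R)).
    by rewrite sum_user E3_channel.
  apply: eq_bigr => a _; congr (_ * _).
  rewrite -/(upd w t a) -/(St (upd w t a)) ffunE eqxx.
  have pz := (is_pmf_prod (fun i : 'I_n => HPZX (a.1 i))).2.
  rewrite -[X in X - _]pz -sumrB; apply: eq_bigr => z _.
  rewrite -[X in X - _]mulr1 -mulrBr; congr (_ * _).
  rewrite /B -St_upd; set b := g _ z.
  have [->|bw] := eqVneq b w; last by rewrite mul0r subrr.
  by rewrite !ffunE eqxx mul1r; case: leP; rewrite ?subr0 ?subrr.
(* Redrawing w restores a full vector of messages independent of z, and the events that the decoder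
   answers w partition the space. *)
have indep_sum : \sum_w Ex (fun=> @userlaw R X Y PX PYX n) (indep w) = 1.
  transitivity (\sum_w Ex (fun=> @userlaw R X Y PX PYX n)
      (fun t => Ex (fun=> zlaw PX PZX) (fun z => (g (St t) z == w)%:R))).
    apply: eq_bigr => w _; rewrite -[RHS](Ex_resample w _ up); apply: eq_Ex => t.
    have -> : indep w t = \sum_(a : user n) userlaw PX PYX a *
        Ex (fun=> zlaw PX PZX) (fun z => (B w t (f a.2) z)%:R).
      by rewrite (sum_user_y PX PYX
        (fun y => Ex (fun=> zlaw PX PZX) (fun z => (B w t (f y) z)%:R))).
    apply: eq_bigr => a _; congr (_ * _).
    by apply: eq_Ex => z; rewrite -/(upd w t a) St_upd.
  rewrite -Ex_sum -[RHS](Ex_const _ up); apply: eq_Ex => t.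
  rewrite -Ex_sum -[RHS](Ex_const _ zp); apply: eq_Ex => z.
  by rewrite (bigD1 (g (St t) z)) //= eqxx big1 ?addr0 // => w; rewrite eq_sym => /negbTE ->.
(* One functional secures both bounds: the sum over w has mean Mp/2 + Mp/2 - M(1 - error) <= 0, and
   [G w t <= 0] yields joint >= p/2 as well as indep <= 2 joint/(Mp). *)
pose G w t := M%:R * p / 2 * indep w t + p / 2 - joint w t.
have HG : Ex (fun=> @userlaw R X Y PX PYX n) (fun t => \sum_w G w t) <= 0.
  rewrite (Ex_sum _ xpredT G) /G.
  under eq_bigr do rewrite ExB ExD Ex_const // ExZ.
  rewrite sumrB big_split -big_distrr /= joint_sum indep_sum sumr_const card_ord.
  rewrite -[_ *+ _]mulr_natl.
  have : M%:R * p <= M%:R * (1 - error_prob PX PYX PZX d f g h D) by rewrite ler_pM2l.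
  lra.
have [t Ht] := Ex_exists_le up HG.
have [w Hw] : exists w, G w t <= 0.
  have [w Hw|N] := pickP (fun w => G w t <= 0); first by exists w.
  have G0 w : 0 < G w t by rewrite ltNge N.
  move: Ht; rewrite (bigD1 (Ordinal M0)) //= leNgt ltr_pwDl //.
  by apply: sumr_ge0 => w _; apply: ltW.
exists (B w t); rewrite -/(joint w t) -/(indep w t).
have i0 : 0 <= indep w t by apply: Ex_ge0 => // y; apply: Ex_ge0.
have j1 : joint w t <= 1.
  rewrite -[leRHS](Ex_const _ l3); apply: le_Ex => // u.
  by rewrite -natrM lern1 mulnb leq_b1.
have Mp0 : 0 < M%:R * p by rewrite mulr_gt0.
have Mi0 : 0 <= M%:R * p * indep w t by rewrite mulr_ge0 // ltW.
rewrite /G in Hw; split; first by lra.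
by rewrite ler_pdivlMr //; lra.
Qed.
End Converse.

(** * Disintegration of the joint law *)

Section Disintegration.
Variable R : realType.

Lemma cond_kernel (A B : finType) (J : A -> B -> R) : (0 < #|B|)%N ->
  (forall a b, 0 <= J a b) ->
  exists2 K : A -> B -> R, is_channel K & forall a b, J a b = (\sum_b' J a b') * K a b.
Proof.
move=> /card_gt0P[b0 _] J0; pose m a := \sum_b J a b.
(* Rows of zero mass receive a point mass at [b0], so that every row is a distribution. *)
exists (fun a b => if m a == 0 then (b == b0)%:R else J a b / m a).
  move=> a; have [ma|ma] := eqVneq (m a) 0; split.
  - by move=> b; rewrite ler0n.
  - by rewrite (bigD1 b0) //= eqxx big1 ?addr0 // => b /negbTE ->.
  - by move=> b; rewrite divr_ge0 // sumr_ge0.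
  - by rewrite -big_distrl /= divff.
move=> a b; rewrite -/(m a); have [ma|ma] := eqVneq (m a) 0.
  rewrite ma mul0r; have /eqP := ma; rewrite psumr_eq0 => [/allP/(_ b)|b' _ //].
  by rewrite mem_index_enum => /(_ isT)/eqP.
by rewrite mulrC divfK.
Qed.

Variables (X Y Z : finType) (PX : X -> R) (PYX : X -> Y -> R) (PZX : X -> Z -> R).
Hypotheses (HPX : is_pmf PX) (HPYX : is_channel PYX) (HPZX : is_channel PZX).

(** The triple is regenerated as y, then z given y, then x given both, which is the form used by the
    block construction. *)
Lemma disintegration : exists (W : Y -> Z -> R) (V : Y -> Z -> X -> R),
  [/\ is_channel W, forall y z, is_pmf (V y z),
      forall x y z, ylaw PX PYX y * W y z * V y z x = law3 PX PYX PZX (x, y, z) &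
      forall z, outlaw (ylaw PX PYX) W z = zlaw PX PZX z].
Proof.
have X0 := pmf_inhabited HPX; have [x0 _] := card_gt0P X0.
have l0 t : 0 <= law3 PX PYX PZX t by apply: (law3_pmf HPX HPYX HPZX).1.
pose J y z := \sum_x law3 PX PYX PZX (x, y, z).
have [W Wp HW] := @cond_kernel Y Z J (pmf_inhabited (HPZX x0)) (fun y z => sumr_ge0 _ (fun x _ => l0 _)).
have [V Vp HV] := @cond_kernel (Y * Z)%type X (fun yz x => law3 PX PYX PZX (x, yz.1, yz.2)) X0
  (fun _ _ => l0 _).
have Jy y : \sum_z J y z = ylaw PX PYX y.
  rewrite /J exchange_big; apply: eq_bigr => x _.
  by rewrite /law3 /= -big_distrr /= (HPZX x).2 mulr1.
have HW' y z : J y z = ylaw PX PYX y * W y z by rewrite HW Jy.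
exists W, (fun y z => V (y, z)); split => //.
  by move=> x y z; rewrite -HW' -(HV (y, z) x).
move=> z; rewrite /outlaw; under eq_bigr do rewrite -HW'.
rewrite exchange_big; apply: eq_bigr => x _.
by rewrite /law3 /= -big_distrl -big_distrr /= (HPYX x).2 mulr1.
Qed.

Lemma E3_disintegrated n (W : Y -> Z -> R) (V : Y -> Z -> X -> R)
  (F : {ffun 'I_n -> X} -> {ffun 'I_n -> Y} -> {ffun 'I_n -> Z} -> R) :
  (forall x y z, ylaw PX PYX y * W y z * V y z x = law3 PX PYX PZX (x, y, z)) ->
  Ex (fun=> ylaw PX PYX) (fun y => Ex (fun i => W (y i)) (fun z =>
    Ex (fun i => V (y i) (z i)) (fun x => F x y z))) = E3 PX PYX PZX F.
Proof.
move=> HV.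
transitivity (\sum_(y : {ffun 'I_n -> Y}) \sum_(z : {ffun 'I_n -> Z})
    \sum_(x : {ffun 'I_n -> X}) (\prod_i ylaw PX PYX (y i) * \prod_i W (y i) (z i) *
    \prod_i V (y i) (z i) (x i)) * F x y z).
  apply: eq_bigr => y _; rewrite big_distrr; apply: eq_bigr => z _ /=.
  by rewrite !big_distrr; apply: eq_bigr => x _ /=; rewrite !mulrA.
under eq_bigr do rewrite exchange_big; rewrite exchange_big /=.
rewrite (sum_ffun_triple (fun x y z => (\prod_i ylaw PX PYX (y i) * \prod_i W (y i) (z i) *
    \prod_i V (y i) (z i) (x i)) * F x y z)).
apply: eq_bigr => t _; congr (_ * _).
rewrite -!big_split; apply: eq_bigr => i _ /=; rewrite !ffunE HV.
by case: (t i) => [[]].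
Qed.
End Disintegration.

Lemma dist_bounded (R : realType) (X Xh : finType) (d : X -> Xh -> R) :
  (forall x xh, 0 <= d x xh) ->
  exists2 C : R, 0 < C & forall x xh, 0 <= d x xh <= C.
Proof.
move=> d0; exists (1 + \sum_x \sum_xh d x xh).
  by rewrite ltr_pwDl // sumr_ge0 // => x _; apply: sumr_ge0.
move=> x xh; rewrite d0 /= (bigD1 x) //= (bigD1 xh) //=.
have S1 : 0 <= \sum_(xh' | xh' != xh) d x xh' by apply: sumr_ge0.
have S2 : 0 <= \sum_(x' | x' != x) \sum_xh' d x' xh'.
  by apply: sumr_ge0 => x' _; apply: sumr_ge0.
lra.
Qed.

(** [g], [E] and [N] precede the code, so one long code with success probability at least exp(-nE)
    gives achievability for every [eps]. *)
Lemma good_code_achievable (R : realType) (X Y Z Xh : finType)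
  (PX : X -> R) (PYX : X -> Y -> R) (PZX : X -> Z -> R) (d : X -> Xh -> R)
  (Ri Rc D rho : R) :
  is_pmf PX -> is_channel PYX -> is_channel PZX -> (forall x xh, 0 <= d x xh) ->
  0 < rho ->
  exists g E : R, [/\ 0 < g, 0 < E & exists N, forall n M L
    (f : {ffun 'I_n -> Y} -> 'I_L)
    (g' : {ffun 'I_M -> 'I_L} -> {ffun 'I_n -> Z} -> 'I_M)
    (h : 'I_L -> {ffun 'I_n -> Z} -> {ffun 'I_n -> Xh}),
    (N <= n)%N -> (0 < M)%N ->
    n%:R * (Ri - g) <= ln M%:R -> ln L%:R <= n%:R * (Rc + g) ->
    expR (- (n%:R * E)) <= 1 - error_prob PX PYX PZX d f g' h D ->
    forall eps, 0 < eps ->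
    eps_achievable PX PYX PZX d eps (Ri - rho, Rc + rho, D + rho)].
Proof.
move=> HPX HPYX HPZX Hd rho0.
have [C C0 dC] := dist_bounded Hd.
have [W [V [Wp Vp HV HW]]] := disintegration HPX HPYX HPZX.
have ylp : is_pmf (ylaw PX PYX) by apply: outlaw_pmf.
(* The rate loss is 4g + 2g|Ri|, here at most rho/2; the other half of rho covers the additive 1 of
   [superblock_achievable]. *)
pose g := Num.min (2^-1) (rho / (8 + 4 * `|Ri|)).
have R0 : 0 < 8 + 4 * `|Ri| by rewrite ltr_pwDl // mulr_ge0.
have g0 : 0 < g by rewrite lt_min invr_gt0 ltr0n divr_gt0.
have g1 : 0 < g <= 1.
  have : g <= 2^-1 by rewrite ge_min lexx.
  by move=> ?; apply/andP; split; lra.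
have gr : g * (8 + 4 * `|Ri|) <= rho by rewrite -ler_pdivlMr // ge_min lexx orbT.
have gR0 : 0 <= g * `|Ri| by rewrite mulr_ge0 // ltW.
have [del del0 [N1 HB]] := block_lemma ylp Wp Vp C0 dC g0.
(* With E <= del/2, the remaining half of [del] absorbs the factor 1/2 lost in [one_user_test]. *)
pose E := Num.min g (del / 2).
have E0 : 0 < E by rewrite lt_min g0 divr_gt0.
have Eg : E <= g by rewrite ge_min lexx.
have Ed : E <= del / 2 by rewrite ge_min lexx orbT.
exists g, E; split => //.
have p1 : 0 < 4 / rho by rewrite divr_gt0.
have p2 : 0 < 2 / del by rewrite divr_gt0.
have p3 : 0 < 1 / g by rewrite divr_gt0.
pose N0 := 4 / rho + 2 / del + 1 / g.
exists (maxn N1 (Num.truncn N0).+1) => n M L f g' h.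
rewrite geq_max => /andP[nN1 nN0] M0 HM HL succ eps eps0.
have NN : N0 <= n%:R by rewrite (le_trans (ltW (truncnS_gt N0))) // ler_nat.
have n1 : 4 <= n%:R * rho by rewrite -ler_pdivrMr //; clear -p1 p2 p3 NN; rewrite /N0 in NN; lra.
have n2 : 2 <= n%:R * del by rewrite -ler_pdivrMr //; clear -p1 p2 p3 NN; rewrite /N0 in NN; lra.
have n3 : 1 <= n%:R * g by rewrite -ler_pdivrMr //; clear -p1 p2 p3 NN; rewrite /N0 in NN; lra.
have n0 : (0 < n)%N by apply: leq_ltn_trans nN0.
have nR0 : 0 < n%:R :> R by rewrite ltr0n.
have MR0 : 0 < M%:R :> R by rewrite ltr0n.
have two (a : R) : 1 <= a -> 2 <= expR a.
  by move=> a1; apply: le_trans (expR_ge1Dx a); clear -a1; lra.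
have [B [HB1 HB2]] := one_user_test HPX HPYX HPZX M0 (expR_gt0 _) succ.
(* A negative [D] would make success impossible. *)
have D0 : 0 <= D.
  rewrite leNgt; apply/negP => Dn; have := HB1; rewrite /E3.
  under eq_Ex => t.
    rewrite (_ : (avg_dist d _ _ <= D) = false) ?mulr0; last first.
      apply/negP => H; have : 0 <= D; last by rewrite leNgt Dn.
      by apply: le_trans H; rewrite divr_ge0 // sumr_ge0.
    over.
  rewrite Ex_const; last by move=> i; apply: law3_pmf.
  by rewrite leNgt divr_gt0 // expR_gt0.
have S1 : expR (- (n%:R * del)) <= Ex (fun=> ylaw PX PYX) (fun y =>
    Ex (fun i => W (y i)) (fun z => (B (f y) z)%:R *
    Ex (fun i => V (y i) (z i)) (fun x => (avg_dist d x (h (f y) z) <= D)%R%:R))).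
  rewrite (eq_Ex _ (fun y => eq_Ex _ (fun z => esym (ExZ _ _ _)))).
  rewrite (E3_disintegrated (fun x y z => (B (f y) z)%:R *
    (avg_dist d x (h (f y) z) <= D)%R%:R) HV).
  apply: le_trans HB1; rewrite ler_pdivlMr //.
  have a1 : n%:R * E <= n%:R * (del / 2) by rewrite ler_wpM2l.
  apply: (@le_trans _ _ (expR (- (n%:R * del)) * expR (n%:R * del / 2))).
    by rewrite ler_wpM2l ?expR_ge0 // two //; clear -n2; lra.
  by rewrite -expRD ler_expR; clear -a1; lra.
have outE : outlaw (ylaw PX PYX) W = zlaw PX PZX by apply/funext.
rewrite outE in HB.
have [S [F [B1 [H [HS Hacc Hfa Hdist]]]]] := HB n nN1 _ f B h D _ D0 S1 HB2.
(* The loss 4g collects the block refinement, the constant 2, the slack in the rate of M, and E,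
   each at most g. The maximum with 0 keeps [tau] nonnegative, the bound being trivial at 0. *)
pose tau := n%:R * Num.max (Ri - 4 * g) 0.
have tau0 : 0 <= tau by rewrite mulr_ge0 // le_max lexx orbT.
have tau1 : n%:R * (Ri - 4 * g) <= tau by rewrite ler_wpM2l // le_max lexx.
have tau2 : tau <= n%:R * `|Ri|.
  rewrite ler_wpM2l // ge_max normr_ge0 andbT.
  by have H1 := ler_norm Ri; clear -H1 g0; lra.
have [x0 _] := card_gt0P (pmf_inhabited HPX).
have [y0 _] := card_gt0P (pmf_inhabited (HPYX x0)).
have [z0 _] := card_gt0P (pmf_inhabited (HPZX x0)).
(* A reproduction letter is read off the given code, as n is positive. *)
have xh0 : Xh := h (f [ffun=> y0]) [ffun=> z0] (Ordinal n0).
have S0 : (0 < #|S|)%N by apply/card_gt0P; exists (F [ffun=> y0]).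
have L0 : (0 < L)%N by apply: leq_ltn_trans (ltn_ord (f [ffun=> y0])).
apply: (@superblock_achievable R X Y Z Xh PX PYX PZX d C HPX HPYX HPZX C0 dC
  n S F B1 H g tau (D + g) (D + rho) (Ri - rho) (Rc + rho) eps xh0) => //.
- by rewrite addr_ge0 // ltW.
- by clear -gr gR0 g0; lra.
- have a1 : g * tau <= g * (n%:R * `|Ri|) by rewrite ler_wpM2l // ltW.
  have a2 : n%:R * (g * (8 + 4 * `|Ri|)) <= n%:R * rho by rewrite ler_wpM2l.
  clear -a1 a2 tau1 n1; lra.
- apply: (@le_trans _ _ (ln (L%:R * expR (n%:R * g)))).
    by rewrite ler_ln ?posrE ?ltr0n ?mulr_gt0 ?expR_gt0 ?ltr0n //; rewrite card_ord in HS.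
  rewrite lnM ?posrE ?ltr0n ?expR_gt0 // expRK.
  have a2 : n%:R * (g * (8 + 4 * `|Ri|)) <= n%:R * rho by rewrite ler_wpM2l.
  have a3 : 0 <= n%:R * (g * `|Ri|) by rewrite mulr_ge0.
  clear -a2 a3 HL n3; lra.
- rewrite -(E3_disintegrated (fun _ y z => (B1 (F y) z)%:R) HV).
  apply: (le_trans Hacc); apply: eq_imp_le; apply: eq_Ex => y; apply: eq_Ex => z.
  by rewrite Ex_const.
- rewrite /tau; case: (leP (Ri - 4 * g) 0) => [_|_].
    rewrite mulr0 oppr0 expR0.
    rewrite -[leRHS](@Ex_const R 'I_n _ (fun=> ylaw PX PYX) 1) //; apply: le_Ex => // y.
    have zlp : is_pmf (zlaw PX PZX) by apply: outlaw_pmf.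
    rewrite -[leRHS](@Ex_const R 'I_n _ (fun=> zlaw PX PZX) 1) //; apply: le_Ex => // z.
    by rewrite lern1 leq_b1.
  apply: (le_trans Hfa).
  have -> : 2 / (M%:R * expR (- (n%:R * E))) = 2 * M%:R^-1 * expR (n%:R * E).
    by rewrite invfM mulrA expRN invrK.
  have M1 : M%:R^-1 <= expR (- (n%:R * (Ri - g))).
    by rewrite expRN lef_pV2 ?posrE ?expR_gt0 // -ler_ln ?posrE ?expR_gt0 // expRK.
  apply: (@le_trans _ _ (expR (n%:R * g) * (expR (n%:R * g) * expR (- (n%:R * (Ri - g))) *
     expR (n%:R * E)))).
    rewrite ler_wpM2l ?expR_ge0 // ler_wpM2r ?expR_ge0 //.
    by apply: ler_pM; rewrite ?invr_ge0 // two.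
  rewrite -!expRD ler_expR.
  have a1 : n%:R * E <= n%:R * g by rewrite ler_wpM2l.
  clear -a1; lra.
- by rewrite -(E3_disintegrated (fun x y z => avg_dist d x (H (F y) z)) HV).
Qed.

Local Open Scope classical_set_scope.

Theorem theorem4 (R : realType) (X Y Z Xh : finType)
  (PX : X -> R) (PYX : X -> Y -> R) (PZX : X -> Z -> R) (d : X -> Xh -> R)
  (HPX : is_pmf PX) (HPYX : is_channel PYX) (HPZX : is_channel PZX)
  (Hd : forall x xh, 0 <= d x xh)
  (Ri Rc D : R) (M L : nat -> nat)
  (f : forall n, {ffun 'I_n -> Y} -> 'I_(L n))
  (g : forall n, {ffun 'I_(M n) -> 'I_(L n)} -> {ffun 'I_n -> Z} -> 'I_(M n))
  (h : forall n, 'I_(L n) -> {ffun 'I_n -> Z} -> {ffun 'I_n -> Xh})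
  (HM : forall n, (0 < M n)%N) :
  (limn_esup (fun n => (ln (L n)%:R / n%:R)%:E) <= Rc%:E)%E ->
  (Ri%:E <= limn_einf (fun n => (ln (M n)%:R / n%:R)%:E))%E ->
  ~ region PX PYX PZX d (Ri, Rc, D) ->
  exists E : R, 0 < E /\
    \forall n \near \oo,
      1 - error_prob PX PYX PZX d (f n) (g n) (h n) D <= expR (- (n%:R * E)).
Proof.
(* By contraposition, for each [eps] every neighbourhood of the triple must meet the achievable
   set. *)
move=> HL HMi; apply: contra_notP => noE eps /andP[eps0 _] U /nbhs_ballP[r /= r0 rU].
have rho0 : 0 < r / 2 by rewrite divr_gt0.
have [gam [E [gam0 E0 [N HN]]]] :=
  good_code_achievable Ri Rc D HPX HPYX HPZX Hd rho0.
have [N1 HN1] : exists N, forall n, (N <= n)%N -> ln (L n)%:R / n%:R < Rc + gam.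
  have : (limn_esup (fun n => (ln (L n)%:R / n%:R)%:E) < (Rc + gam)%:E)%E.
    by apply: le_lt_trans HL _; rewrite lte_fin ltrDl.
  by move=> /limn_esup_lt[N1 H1]; exists N1 => n /H1; rewrite lte_fin.
have [N2 HN2] : exists N, forall n, (N <= n)%N -> Ri - gam < ln (M n)%:R / n%:R.
  have : ((Ri - gam)%:E < limn_einf (fun n => (ln (M n)%:R / n%:R)%:E))%E.
    by apply: lt_le_trans HMi; rewrite lte_fin gtrBl.
  by move=> /limn_einf_gt[N2 H2]; exists N2 => n /H2; rewrite lte_fin.
(* The entry 1 makes n positive, so the normalized rates can be multiplied out. *)
pose N3 := maxn (maxn N N1) (maxn N2 1).
(* The failure of exponential decay is used at a single length, since [good_code_achievable] builds
   the codes of all lengths from one block code. *)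
have [n nN3 Hn] : exists2 n, (N3 <= n)%N &
    expR (- (n%:R * E)) < 1 - error_prob PX PYX PZX d (f n) (g n) (h n) D.
  apply: contrapT => Hno; apply: noE; exists E; split => //.
  exists N3 => // n /= nN3; rewrite leNgt; apply/negP => H.
  by apply: Hno; exists n.
move: nN3; rewrite !geq_max => /andP[/andP[nN nN1] /andP[nN2 n0]].
have nR0 : 0 < n%:R :> R by rewrite ltr0n.
exists (Ri - r / 2, Rc + r / 2, D + r / 2); split.
  apply: (HN n (M n) (L n) (f n) (g n) (h n)) => //; last exact: ltW.
    by rewrite mulrC -ler_pdivlMr // ltW // HN2.
  by rewrite mulrC -ler_pdivrMr // ltW // HN1.
have r2 : `|r / 2| < r by rewrite ger0_norm; lra.
apply: rU; split; first split; rewrite /ball /= ?opprB ?opprD.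
- by rewrite addrC subrK.
- by rewrite addrA subrr sub0r normrN.
- by rewrite addrA subrr sub0r normrN.
Qed.
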